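(* Let $P$ be a one vertex GBS monoid with data $A=A_+\amalg A_-$, $(n_e)_{e\in A}$, $(m_e)_{e\in A}$ as in the context. The complete list of non-empty closed invariant subspaces of $\Omega$, with inclusion relations precisely as indicated, is given as follows: (i) if $0<\#A_+<\infty$ and $\#A_-=0$: the subspaces $\partial\Omega,\ \Omega_{A,\infty},\ \Omega_{b,\infty},\ \Omega_\infty,\ \Omega$, with $\partial\Omega\subsetneq\Omega_{A,\infty}\subsetneq\Omega_\infty\subsetneq\Omega$ and $\partial\Omega\subsetneq\Omega_{b,\infty}\subsetneq\Omega_\infty$, and with neither of $\Omega_{A,\infty}$, $\Omega_{b,\infty}$ contained in the other; (ii) if $\#A_+=0$ and $0<\#A_-<\infty$: $\partial\Omega=\Omega_{A,\infty}\subsetneq\Omega_\infty=\Omega_{b,\infty}\subsetneq\Omega$; (iii) if $0<\#A_+<\infty$ and $0<\#A_-<\infty$: $\partial\Omega\subsetneq\Omega_{b,\infty}\subsetneq\Omega_\infty\subsetneq\Omega$; (iv) if $\#A_+=0$ and $\#A_-=\infty$: $\partial\Omega=\Omega_{b,\infty}=\Omega_\infty\subsetneq\Omega$; (v) if $0<\#A_+<\infty$ and $\#A_-=\infty$: $\partial\Omega=\Omega_{b,\infty}\subsetneq\Omega_\infty\subsetneq\Omega$; (vi) if $\#A_+=\infty$: $\partial\Omega=\Omega_{b,\infty}\subsetneq\Omega$.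
   Context: One vertex GBS (generalized Baumslag-Solitar) monoids. Let $A=A_+\amalg A_-$ be a non-empty countable set with a decomposition into two disjoint subsets, and let $m_e,n_e\geq1$ be integers for $e\in A$. Let $$G=\langle\{b\}\cup A\mid b^{n_e}e=eb^{m_e}\ (e\in A_+),\ b^{n_e}eb^{m_e}=e\ (e\in A_-)\rangle$$ and let $P\subseteq G$ be the submonoid generated by $\{b\}\cup A$; $P$ is given by the same presentation as a monoid, it is right LCM (for all $p,q\in P$, $pP\cap qP$ is empty or of the form $rP$), and $P\cap P^{-1}=\{\epsilon\}$, where $\epsilon$ is the identity. The space $\Omega$. Let $\mathcal J=\{pP:p\in P\}\cup\{\emptyset\}$, a semilattice under intersection. $\Omega$ is the set of non-zero maps $\chi:\mathcal J\to\{0,1\}$ with $\chi(I\cap J)=\chi(I)\chi(J)$ and $\chi(\emptyset)=0$, with the topology of pointwise convergence; write $\chi(p):=\chi(pP)$. $G$ acts partially on $\Omega$: for $g\in G$, $g.\chi$ is defined iff $\chi(q)=1$ for some $q\in P$ such that $g=pq^{-1}$ with $p\in P$, and then $(g.\chi)(x)=\chi(qy)$ if $xP\cap pP=pyP$, and $(g.\chi)(x)=0$ if $xP\cap pP=\emptyset$. A subspace $X\subseteq\Omega$ is invariant if $g.\chi\in X$ whenever $\chi\in X$ and $g.\chi$ is defined. $P$ is identified with a subset of $\Omega$ via $p\mapsto\chi_p$, $\chi_p(x)=1$ iff $pP\subseteq xP$. $\Omega_\infty:=\Omega\setminus P$. $\Omega_{\max}$ is the set of $\chi\in\Omega$ for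 which $\chi^{-1}(1)$ is maximal, and $\partial\Omega:=\overline{\Omega_{\max}}$. For a finite or infinite word $w=x_1x_2\cdots$ with letters $x_i\in P$, $\chi_w\in\Omega$ is defined by $\chi_w(p)=1$ iff $x_1\cdots x_i\in pP$ for some $i$; every element of $\Omega$ is of this form. For $e\in A$ let $\theta_e:P\to\mathbb Z_{\geq0}$ be the homomorphism with $\theta_e(b)=0$, $\theta_e(e')=\delta_{e,e'}$ ($e'\in A$); $\theta:=\sum_{e\in A}\theta_e$, extended to infinite words by $\theta(w)=\sum_i\theta(x_i)\in\mathbb Z_{\ge0}\cup\{\infty\}$. Define $\Omega_{A,\infty}:=\{\chi_w\in\Omega:\theta(w)=\infty\}$ and $\Omega_{b,\infty}:=\{\chi\in\Omega:(g.\chi)(b^i)=1$ for all $i\in\mathbb N$ and all $g\in G$ for which $g.\chi$ is defined$\}$. *)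

(* Defs.v *)
From HB Require Import structures.
From mathcomp Require Import all_boot all_order all_algebra.
From mathcomp Require Import all_classical all_reals all_analysis.

Set Implicit Arguments.
Unset Strict Implicit.
Unset Printing Implicit Defensive.

Import GRing.Theory Num.Theory.
Local Open Scope classical_set_scope.
Local Open Scope quotient_scope.
Local Open Scope group_scope.

(* The decomposition A = A_+ ⨿ A_- is given by the membership test of A_+. *)
Record gbs_data := GBSData {
  edge :> countType;
  is_pos : pred edge;
  gn : edge -> nat;
  gm : edge -> nat;
  gn_ge1 : forall e, (1 <= gn e)%N;
  gm_ge1 : forall e, (1 <= gm e)%N;
  edge_inhabited : inhabited edge }.

Section Group.
Variable D : gbs_data.

Definition Apos : set D := [set e | is_pos e].
Definition Aneg : set D := ~` Apos.

(* [None] is b and [Some e] is e. *)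
Definition gen := option D.

(* The letter (x, true) stands for x and (x, false) for its inverse. *)
Definition gword := seq (gen * bool).

Definition pletter (x : gen) : gen * bool := (x, true).
Definition bpow (k : nat) : gword := nseq k (pletter None).

Definition rel_lhs (e : D) : gword :=
  if is_pos e then bpow (gn e) ++ [:: pletter (Some e)]
  else bpow (gn e) ++ pletter (Some e) :: bpow (gm e).
Definition rel_rhs (e : D) : gword :=
  if is_pos e then pletter (Some e) :: bpow (gm e)
  else [:: pletter (Some e)].

Inductive gcong : gword -> gword -> Prop :=
| gcong_refl u : gcong u u
| gcong_sym u v : gcong u v -> gcong v u
| gcong_trans u v w : gcong u v -> gcong v w -> gcong u w
| gcong_cat u u' v v' : gcong u u' -> gcong v v' -> gcong (u ++ v) (u' ++ v')
| gcong_cancel x s : gcong [:: (x, s); (x, ~~ s)] [::]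
| gcong_rel e : gcong (rel_lhs e) (rel_rhs e).

Definition gcongb : rel gword := fun u v => `[< gcong u v >].

Lemma gcongb_equiv : equiv_class_of gcongb.
Proof.
split=> [u|u v|v u w].
- exact/asboolP/gcong_refl.
- by apply/asboolP/asboolP; exact: gcong_sym.
- by move=> /asboolP uv /asboolP vw; apply/asboolP; exact: gcong_trans uv vw.
Qed.

Canonical gcong_equiv := EquivRelPack gcongb_equiv.

Definition G := {eq_quot gcong_equiv}.
HB.instance Definition _ := Choice.on G.

Definition cls (w : gword) : G := \pi_G w.

Lemma cls_eqP u v : cls u = cls v <-> gcong u v.
Proof.
split=> [/eqP|h]; first by rewrite eqmodE => /asboolP.
by apply/eqP; rewrite eqmodE; apply/asboolP.
Qed.

Lemma cls_repr (g : G) : cls (repr g) = g.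
Proof. exact: reprK. Qed.

Definition ginv_word (w : gword) : gword :=
  rev [seq (l.1, ~~ l.2) | l <- w].

Lemma gcong_invr w : gcong (w ++ ginv_word w) [::].
Proof.
elim: w => [|[x s] w IH]; first exact: gcong_refl.
have -> : ((x, s) :: w) ++ ginv_word ((x, s) :: w) =
    [:: (x, s)] ++ ((w ++ ginv_word w) ++ [:: (x, ~~ s)]).
  by rewrite /ginv_word /= rev_cons -cats1 -catA.
apply: gcong_trans (gcong_cancel x s).
rewrite -[X in gcong _ X](cat1s (x, s)); apply: gcong_cat; first exact: gcong_refl.
by rewrite -[X in gcong _ X]cat0s; apply: gcong_cat => //; exact: gcong_refl.
Qed.

Lemma ginv_wordK w : ginv_word (ginv_word w) = w.
Proof.
rewrite /ginv_word map_rev revK -map_comp -[RHS]map_id.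
by apply: eq_map => -[x s] /=; rewrite negbK.
Qed.

Lemma gcong_invl w : gcong (ginv_word w ++ w) [::].
Proof. by rewrite -[X in _ ++ X]ginv_wordK; exact: gcong_invr. Qed.

Definition gmul (g h : G) : G := cls (repr g ++ repr h).
Definition gone : G := cls [::].
Definition ginv (g : G) : G := cls (ginv_word (repr g)).

Lemma gcong_repr w : gcong (repr (cls w)) w.
Proof. by apply/cls_eqP; rewrite cls_repr. Qed.

Lemma gmul_cls u v : gmul (cls u) (cls v) = cls (u ++ v).
Proof. by apply/cls_eqP; apply: gcong_cat; exact: gcong_repr. Qed.

Lemma gmulA : associative gmul.
Proof.
move=> f g h; rewrite -(cls_repr f) -(cls_repr g) -(cls_repr h).
by rewrite !gmul_cls catA.
Qed.

Lemma gmul1 : left_id gone gmul.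
Proof. by move=> g; rewrite -(cls_repr g) gmul_cls. Qed.

Lemma gmul1r : right_id gone gmul.
Proof. by move=> g; rewrite -(cls_repr g) gmul_cls cats0. Qed.

Lemma gmulV : left_inverse gone ginv gmul.
Proof.
move=> g; rewrite -[X in gmul _ X]cls_repr gmul_cls.
by apply/cls_eqP; exact: gcong_invl.
Qed.

Lemma gmulrV : right_inverse gone ginv gmul.
Proof.
move=> g; rewrite -[X in gmul X _]cls_repr gmul_cls.
by apply/cls_eqP; exact: gcong_invr.
Qed.

HB.instance Definition _ := isGroup.Build G gmulA gmul1 gmul1r gmulV gmulrV.

Definition ggen (x : gen) : G := cls [:: pletter x].

Definition Pset : set G :=
  smallest [set S : set G | S 1 /\ (forall g h, S g -> S h -> S (g * h))]
           (range ggen).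

Lemma Pset1 : Pset 1.
Proof. by move=> S [[]]. Qed.

Lemma PsetM g h : Pset g -> Pset h -> Pset (g * h).
Proof. by move=> Pg Ph S HS; apply: HS.1.2; [exact: Pg|exact: Ph]. Qed.

Lemma Pset_gen x : Pset (ggen x).
Proof. by move=> S [_]; apply; exists x. Qed.

Definition Ppred : {pred G} := fun g => g \in Pset.

Lemma Ppred_closed : umagma_closed Ppred.
Proof.
split=> [|g h Pg Ph]; first exact: mem_set Pset1.
exact: mem_set (PsetM (set_mem Pg) (set_mem Ph)).
Qed.

HB.instance Definition _ := isMulClosed.Build G Ppred Ppred_closed.2.
HB.instance Definition _ := isMul1Closed.Build G Ppred Ppred_closed.1.

Record P := MkP { Pval : G; Pvalp : Ppred Pval }.
HB.instance Definition _ := [isSub for Pval].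
HB.instance Definition _ := [Choice of P by <:].
HB.instance Definition _ := SubChoice_isSubMonoid.Build G Ppred P Ppred_closed.

Definition pgen (x : gen) : P := MkP (mem_set (Pset_gen x)).
Definition pb : P := pgen None.
Definition pe (e : D) : P := pgen (Some e).
End Group.

Section Theta.
Variable D : gbs_data.
Local Open Scope ring_scope.

(* theta_e is obtained from the exponent-sum homomorphism G -> Z of the
   generator e, which is nonnegative on P. *)
Definition exponent_sum (e : D) (w : gword D) : int :=
  \sum_(l <- w | l.1 == Some e) (if l.2 then 1 else - 1).

Definition theta_at (e : D) (p : P D) : nat :=
  `|exponent_sum e (repr (Pval p))|%N.

Definition theta (p : P D) : nat := \sum_(e \in [set: D]) theta_at e p.

Lemma exponent_sum_cat e u v :
  exponent_sum e (u ++ v) = exponent_sum e u + exponent_sum e v.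
Proof. by rewrite /exponent_sum big_cat. Qed.

Lemma exponent_sum_bpow e k : exponent_sum e (bpow D k) = 0.
Proof.
by elim: k => [|k IH]; rewrite /exponent_sum ?big_nil //= big_cons.
Qed.

Lemma exponent_sum_cong e u v :
  gcong u v -> exponent_sum e u = exponent_sum e v.
Proof.
elim=> {u v} [u|u v _ ->|u v w _ -> _ ->|u u' v v' _ h _ h'|x s|e'] //.
- by rewrite !exponent_sum_cat h h'.
- rewrite /exponent_sum !big_cons big_nil /=.
  by case: eqP => // _; case: s; rewrite ?addr0 ?subrr ?addNr.
- have consE (l : gen D * bool) w :
      exponent_sum e (l :: w) = exponent_sum e [:: l] + exponent_sum e w.
    by rewrite -cat1s exponent_sum_cat.
  rewrite /rel_lhs /rel_rhs; case: ifP => _.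
    by rewrite exponent_sum_cat (consE _ (bpow D _)) !exponent_sum_bpow addr0 add0r.
  by rewrite exponent_sum_cat (consE _ (bpow D _)) !exponent_sum_bpow addr0 add0r.
Qed.

Lemma exponent_sum_cls e u : exponent_sum e (repr (cls u)) = exponent_sum e u.
Proof. exact/exponent_sum_cong/gcong_repr. Qed.

Lemma exponent_sumM e (g h : G D) :
  exponent_sum e (repr (g * h)%g) =
  exponent_sum e (repr g) + exponent_sum e (repr h).
Proof. by rewrite -exponent_sum_cat; exact: exponent_sum_cls. Qed.

Lemma exponent_sum_gen e x :
  exponent_sum e (repr (ggen x)) = (x == Some e)%:R.
Proof.
by rewrite exponent_sum_cls /exponent_sum big_cons big_nil /=; case: eqP.
Qed.

Lemma exponent_sum_ge0 e (p : P D) : 0 <= exponent_sum e (repr (Pval p)).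
Proof.
case: p => g /= /set_mem Pg.
apply: (Pg [set g : G D | 0 <= exponent_sum e (repr g)]).
split; last by move=> _ [x _ <-] /=; rewrite exponent_sum_gen; case: eqP.
split=> [|f h] /=; last by move=> f0 h0; rewrite exponent_sumM addr_ge0.
by rewrite exponent_sum_cls /exponent_sum big_nil.
Qed.

Lemma theta_atM e (p q : P D) :
  theta_at e (p * q)%g = (theta_at e p + theta_at e q)%N.
Proof.
apply/eqP; rewrite -eqz_nat PoszD /theta_at !gez0_abs ?exponent_sum_ge0 //.
by rewrite exponent_sumM.
Qed.

Lemma theta_at_b e : theta_at e (pb D) = 0%N.
Proof. by rewrite /theta_at exponent_sum_gen. Qed.

Lemma theta_at_e e e' : theta_at e (pe e') = (e == e').
Proof.
rewrite /theta_at exponent_sum_gen (inj_eq Some_inj) eq_sym.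
by case: (e == e').
Qed.

Lemma theta_at_finite (p : P D) : finite_set [set e | theta_at e p != 0%N].
Proof.
set w := repr (Pval p).
apply: (@sub_finite_set _ _ [set` pmap (fun l : gen D * bool => l.1) w]).
  move=> e /=; rewrite mem_pmap => he; apply/negPn/negP => hn.
  move/negP: he; apply; rewrite /theta_at -/w /exponent_sum big_seq_cond big1//.
  move=> l /andP[lw /eqP le]; exfalso; move/negP: hn; apply.
  by rewrite -le map_f.
exact: finite_seq.
Qed.
End Theta.

Section Omega.
Variable D : gbs_data.
Local Notation G := (G D).
Local Notation P := (P D).

Definition pideal (p : P) : set P := range (fun r => p * r).

Definition J : set (set P) := [set I | I = set0 \/ exists p, I = pideal p].

Definition J_of (p : P) : J :=
  exist _ (pideal p) (mem_set (or_intror (ex_intro _ p erefl))).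

(* J is closed under intersection (P is right LCM), so that quantifying over
   the K in J equal to the intersection of I and I' loses no pair (I, I'). *)
Definition Omega_set : set {ptws J -> bool} :=
  [set chi | [/\ exists I, chi I = true,
    forall I I' K : J, set_val K = set_val I `&` set_val I' ->
      chi K = chi I && chi I'
    & forall I : J, set_val I = set0 -> chi I = false]].

(* Carries the subspace topology of the pointwise topology. *)
Definition Omega : topologicalType := Omega_set.

Definition fn (chi : Omega) : J -> bool := \val chi.

Definition ev (chi : Omega) (p : P) : bool := fn chi (J_of p).

(* [acts g chi chi'] : g.chi is defined and equal to chi'.  Since P is right
   LCM, the last two clauses determine chi' on all of J. *)
Definition acts (g : G) (chi chi' : Omega) : Prop :=
  exists p q : P, [/\ g = Pval p * (Pval q)^-1, ev chi q,
    forall x y : P, pideal x `&` pideal p = pideal (p * y) ->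
      ev chi' x = ev chi (q * y)
    & forall x : P, pideal x `&` pideal p = set0 -> ev chi' x = false].

Definition invariant (X : set Omega) : Prop :=
  forall (g : G) (chi chi' : Omega), X chi -> acts g chi chi' -> X chi'.

Definition is_chi_of (p : P) (chi : Omega) : Prop :=
  forall x : P, ev chi x <-> pideal p `<=` pideal x.

Definition Omega_P : set Omega := [set chi | exists p, is_chi_of p chi].
Definition Omega_inf : set Omega := ~` Omega_P.

Definition Omega_max : set Omega :=
  [set chi | forall chi' : Omega,
    [set I | fn chi I] `<=` [set I | fn chi' I] ->
    [set I | fn chi I] = [set I | fn chi' I]].
Definition boundary : set Omega := closure Omega_max.

(* Letters range over all of P, so finite words are the infinite words whose
   letters are eventually 1. *)
Definition word := nat -> P.

Definition is_chi_word (w : word) (chi : Omega) : Prop :=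
  forall p : P, ev chi p <-> exists i, pideal p (\prod_(k < i) w k).

Definition theta_infinite (w : word) : Prop :=
  forall N, exists i, (N <= \sum_(k < i) theta (w k))%N.

Definition Omega_A_inf : set Omega :=
  [set chi | exists2 w, is_chi_word w chi & theta_infinite w].

Definition Omega_b_inf : set Omega :=
  [set chi | forall (g : G) (chi' : Omega), acts g chi chi' ->
    forall i : nat, ev chi' (pb D ^+ i)].

Definition closed_invariant_subspaces : set (set Omega) :=
  [set X | [/\ X !=set0, closed X & invariant X]].
End Omega.

Arguments Apos D : clear implicits.
Arguments Aneg D : clear implicits.
Arguments J D : clear implicits.
Arguments Omega_set D : clear implicits.
Arguments Omega D : clear implicits.
Arguments Omega_P D : clear implicits.
Arguments Omega_inf D : clear implicits.
Arguments Omega_max D : clear implicits.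
Arguments boundary D : clear implicits.
Arguments Omega_A_inf D : clear implicits.
Arguments Omega_b_inf D : clear implicits.
Arguments closed_invariant_subspaces D : clear implicits.

(* Main.v *)
From HB Require Import structures.
Require Import Defs.
From mathcomp Require Import all_boot all_order all_algebra.
From mathcomp Require Import zify finmap.
From mathcomp Require Import all_classical all_reals all_analysis.

(** Write [b^Z] for the cyclic group generated by [b].  The group [G] is an
HNN extension of [b^Z] with one stable letter for each edge, so its elements
have unique reduced forms [b^i1 e1^s1 b^i2 e2^s2 ... b^j] (lemmas
[act_word_cong] and [nfK]).  Elements of [P] are the forms without inverse
edges in which, moreover, [j >= 0] as soon as no edge of [A_-] occurs
([PsetE]).  The exponent [j] aside, such a form is a path [vtx p] issued from
the root of a tree, and [vtx p] can only be extended by multiplication on the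
right.  Hence [pP] and [qP] are disjoint when [vtx p] and [vtx q] are
incomparable for the prefix order, and otherwise [pP] meets [qP] in
[q b^k P], where [q] is the one with the longer path ([lcm_prefix]).

A character is the filter of the elements [p] on which it takes the value 1.
The paths of the elements of a filter form a chain.  [Omega_A_inf] says that
this chain is unbounded, and [Omega_b_inf] that the filter is stable under
[p |-> p b].  A filter whose paths are bounded either is principal or consists
of the left divisors of the powers [p b^k] of one fixed [p]; the latter is
[b]-stable and a principal filter is not.  So [Omega] is the disjoint union of
four invariant strata: the principal filters, the bounded [b]-stable filters,
the unbounded [b]-stable ones, which are exactly [Omega_max], and the
unbounded ones that are not [b]-stable.

Let [X] be non-empty, closed and invariant.  For each stratum, [X] contains
all of it or misses it:
- [Omega_max] is contained in [X], since any [chi] in it is a limit of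
  translates [r.alpha] of an arbitrary [alpha], with [r] running through the
  filter of [chi] ([max_in]);
- one principal filter generates a dense orbit ([principal_dense]);
- the bounded [b]-stable filters form a single orbit ([b_closed_bounded_in]);
- if [alpha] in [X] is not [b]-stable, it may be translated so that it omits
  [b]; then [r.alpha] approximates every unbounded [chi] that is not
  [b]-stable, [r] being an element of [chi] far out with [r b] not in [chi]
  ([not_b_closed_in]).
This leaves the five candidates of [classify].  Which of them are closed, and
which coincide, depends on the edges: when [A] is infinite the bounded
[b]-stable filters are limits of [Omega_max] ([boundary_infinite]), when [A]
is finite [Omega_max] is closed ([closed_max]); an edge of [A_-] makes the
bounded [b]-stable filters limits of translates of any filter that is not
[b]-stable ([neg_edge_b_closed_bounded_in]), infinitely many edges of [A_+]
do the same for principal filters ([infinite_pos_setT]); without edges of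
[A_+] unbounded filters are [b]-stable ([no_pos_b_closed]). *)

Set Implicit Arguments.
Unset Strict Implicit.
Unset Printing Implicit Defensive.

Import Order.TTheory GRing.Theory Num.Theory.
Local Open Scope classical_set_scope.
Local Open Scope group_scope.

(** * Normal forms in the group and in the monoid *)

Section NormalForms.
Variable D : gbs_data.
Local Notation G := (G D).

(** A syllable [(i, (e, s))] stands for [b^i e] if [s] is true and for [b^i
    e^-1] otherwise. *)
Definition syl : Type := int * (D * bool).
Definition sinv (x : D * bool) : D * bool := (x.1, ~~ x.2).
Definition edge_sign (e : D) : int := if is_pos e then 1%R else (- 1)%R.
(** The weights are chosen so that the defining relations become the single
    rule [b^(lweight x * q) x = x b^(rweight x * q)] for a letter [x] of
    either sign. *)
Definition lweight (x : D * bool) : int := Posz (if x.2 then gn x.1 else gm x.1).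
Definition rweight (x : D * bool) : int := (edge_sign x.1 * lweight (sinv x))%R.

Lemma lweight_gt0 x : (0 < lweight x)%R.
Proof. by rewrite /lweight; case: x => e [] /=; rewrite ltz_nat ?gn_ge1 ?gm_ge1. Qed.
Lemma lweight_neq0 x : lweight x != 0%R. Proof. by rewrite gt_eqF ?lweight_gt0. Qed.
Lemma sinvK x : sinv (sinv x) = x.
Proof. by case: x => e s; rewrite /sinv /= negbK. Qed.
Lemma edge_sign2 e : (edge_sign e * edge_sign e = 1)%R.
Proof. by rewrite /edge_sign; case: is_pos. Qed.
Lemma rweight_sinv x : rweight (sinv x) = (edge_sign x.1 * lweight x)%R.
Proof. by rewrite /rweight sinvK. Qed.

(** Multiplication of a word by [b^k] on the left: the first exponent is
    reduced modulo [lweight], and the quotient is carried through the letter.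
    The second component is the power of [b] that comes out on the right. *)
Fixpoint push (k : int) (l : seq syl) : seq syl * int :=
  if l is (i, x) :: l' then
    let r := push (rweight x * ((k + i) %/ lweight x)%Z)%R l' in
    (((k + i)%R %% lweight x, x)%Z :: r.1, r.2)
  else ([::], k).

(** The pair [(l, j)] stands for the word [l] followed by [b^j]. *)
Definition form : Type := seq syl * int.

Definition fpush (k : int) (s : form) : form :=
  ((push k s.1).1, ((push k s.1).2 + s.2)%R).

Definition starts_inv (x : D * bool) (l : seq syl) : bool :=
  if l is (i, y) :: _ then (i == 0%R) && (y == sinv x) else false.

Definition fedge (x : D * bool) (s : form) : form :=
  (if starts_inv x s.1 then behead s.1 else (0%R, x) :: s.1, s.2).

(** Britton reduced words with exponents in the standard range; [starts_inv x
    l] detects a pinch [x b^0 x^-1]. *)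
Fixpoint red (l : seq syl) : bool :=
  if l is (i, x) :: l' then
    [&& (0 <= i)%R, (i < lweight x)%R, ~~ starts_inv x l' & red l']
  else true.

(** Additivity of division with remainder, carried from letter to letter. *)
Lemma pushD (k k' : int) l :
  push (k + k')%R l =
  ((push k (push k' l).1).1, ((push k (push k' l).1).2 + (push k' l).2)%R).
Proof.
elim: l k k' => [|[i x] l IH] k k' //=.
have E : (rweight x * ((k + k' + i) %/ lweight x)%Z =
  rweight x * ((k + ((k' + i) %% lweight x)%Z)%R %/ lweight x)%Z +
  rweight x * ((k' + i) %/ lweight x)%Z)%R.
  rewrite -mulrDr; congr (_ * _)%R.
  rewrite -addrA {1}(divz_eq (k' + i) (lweight x)) addrCA divzMDl ?lweight_neq0 //.
  by rewrite [RHS]addrC.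
rewrite E IH /= modzDmr (_ : k + k' + i = k + (k' + i))%R; last by rewrite addrA.
reflexivity.
Qed.

Lemma push0 l : red l -> push 0%R l = (l, 0%R).
Proof.
elim: l => [|[i x] l IH] //= /and4P[i0 il _ /IH {}IH].
by rewrite add0r divz_small ?i0 ?gtz0_abs ?lweight_gt0 // mulr0 IH /= modz_small ?i0.
Qed.

Lemma rweight_modz x q i :
  ((rweight x * q + i) %% lweight (sinv x) = i %% lweight (sinv x))%Z.
Proof. by rewrite /rweight mulrAC modzMDl. Qed.

(** A pinch is neither created nor destroyed by a carry that comes from the
    letter [x], because such a carry is a multiple of the weight of [x^-1]. *)
Lemma starts_inv_push x q l : red l ->
  starts_inv x (push (rweight x * q)%R l).1 = starts_inv x l.
Proof.
case: l => [|[i y] l] //= /and4P[i0 il _ _].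
case: (y =P sinv x) il => [->|] il; last by rewrite !andbF.
by rewrite rweight_modz modz_small ?i0.
Qed.

Lemma push_red k l : red l -> red (push k l).1.
Proof.
elim: l k => [|[i x] l IH] //= k /and4P[i0 il nst rl].
by rewrite modz_ge0 ?lweight_neq0 //= ltz_pmod ?lweight_gt0 // starts_inv_push // nst IH.
Qed.

Lemma fedge_red x (s : form) : red s.1 -> red (fedge x s).1.
Proof.
case: s => l j /= rl; case: ifP => [|/negbT] st.
  by case: l rl st => [|[i y] l] //= /and4P[].
by rewrite /= lweight_gt0 st rl.
Qed.

Lemma fedgeK x (s : form) : red s.1 -> fedge (sinv x) (fedge x s) = s.
Proof.
case: s => l j /= rl; rewrite /fedge /=; case: (boolP (starts_inv x l)) => st /=.
  case: l rl st => [|[i y] l] //= /and4P[_ _ nst _] /andP[/eqP -> /eqP yE].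
  by rewrite -yE (negbTE nst).
by rewrite sinvK eqxx.
Qed.

Lemma fpushD k k' s : fpush (k + k')%R s = fpush k (fpush k' s).
Proof. by rewrite /fpush pushD /= addrA. Qed.

Lemma fpush0 s : red s.1 -> fpush 0%R s = s.
Proof. by case: s => l j /= rl; rewrite /fpush /= push0 // add0r. Qed.

Lemma fpush_red k s : red s.1 -> red (fpush k s).1.
Proof. exact: push_red. Qed.

(** The relation of [x] holds for the action on reduced forms. If [x] cancels
    against a leading [x^-1], the carry returns through that letter, and the
    two signs compensate. *)
Lemma fpush_fedge x q s : red s.1 ->
  fpush (lweight x * q)%R (fedge x s) = fedge x (fpush (rweight x * q)%R s).
Proof.
case: s => l j /= rl; rewrite /fpush /fedge /= starts_inv_push //.
case: (boolP (starts_inv x l)) => st /=.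
  case: l rl st => [|[i y] l] //= _ /andP[/eqP -> /eqP ->].
  have -> : ((rweight x * q + 0) %/ lweight (sinv x))%Z = (edge_sign x.1 * q)%R.
    by rewrite addr0 /rweight mulrAC mulzK ?lweight_neq0.
  by rewrite rweight_sinv mulrACA edge_sign2 mul1r.
by rewrite addr0 mulrC mulzK ?lweight_neq0 // modzMl mulrC.
Qed.

Definition act_letter (a : gen D * bool) (s : form) : form :=
  match a.1 with
  | None => fpush (if a.2 then 1 else - 1)%R s
  | Some e => fedge (e, a.2) s
  end.

Definition act_word (w : gword D) (s : form) : form := foldr act_letter s w.

Lemma act_word_cat u v s : act_word (u ++ v) s = act_word u (act_word v s).
Proof. exact: foldr_cat. Qed.

Lemma act_word_red w s : red s.1 -> red (act_word w s).1.
Proof.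
move=> rs; elim: w => [|[[e|] b] w IH] //=; rewrite /act_letter /=.
  exact: fedge_red.
exact: fpush_red.
Qed.

Lemma act_bpow k s : red s.1 -> act_word (bpow D k) s = fpush (Posz k) s.
Proof.
move=> rs; elim: k => [|k IH]; first by rewrite fpush0.
by rewrite /= IH /act_letter /= -fpushD -intS.
Qed.

(** Van der Waerden's argument: as the relations hold for the action on
    reduced forms, the action of a word depends on its class in [G] only, and
    uniqueness of reduced forms follows without confluence arguments. *)
Lemma act_word_cong u v : gcong u v ->
  forall s, red s.1 -> act_word u s = act_word v s.
Proof.
elim=> {u v} [//|u v _ IH s rs|u v w _ IH _ IH' s rs
  |u u' v v' _ IH _ IH' s rs|x b s rs|e s rs].
- by rewrite IH.
- by rewrite IH ?IH'.
- by rewrite !act_word_cat IH' // IH //; exact: act_word_red.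
- case: x => [e|] /=; rewrite /act_letter /=.
    by rewrite -{1}(negbK b) (@fedgeK (e, ~~ b)).
  by rewrite -fpushD; case: b; rewrite ?subrr ?addNr fpush0.
- rewrite /rel_lhs /rel_rhs.
  have := @fpush_fedge (e, true) 1%R; rewrite !mulr1 /rweight /lweight /edge_sign /=.
  case: is_pos => R; rewrite ?act_word_cat /= /act_letter /= !act_bpow //.
  + by rewrite R // mul1r.
  + exact: fedge_red.
  + rewrite R; last exact: fpush_red.
    by rewrite -fpushD mulN1r addNr fpush0.
  + by apply: fedge_red; apply: fpush_red.
Qed.

Definition nf (g : G) : form := act_word (repr g) ([::], 0%R).

Lemma nf_red g : red (nf g).1. Proof. exact: act_word_red. Qed.

Lemma nf_cls_mul w h : nf (cls w * h) = act_word w (nf h).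
Proof.
rewrite /nf -act_word_cat; apply: act_word_cong => //.
apply: gcong_trans (gcong_repr _) _.
by apply: gcong_cat; [exact: gcong_repr|exact: gcong_refl].
Qed.

Lemma nf1 : nf 1 = ([::], 0%R).
Proof. exact: (act_word_cong (gcong_repr _)). Qed.

Definition bpowz (k : int) : G :=
  match k with
  | Posz n => ggen None ^+ n
  | Negz n => (ggen None ^+ n.+1)^-1
  end.

Lemma bpowzS k : bpowz (1 + k)%R = ggen None * bpowz k.
Proof.
case: k => [n|[|n]].
- by rewrite -intS /= expgS.
- by rewrite /= expg1 mulgV.
- have -> : (1 + Negz n.+1 = Negz n)%R by lia.
  by rewrite /= [in RHS]expgSr invgM mulgA mulgV mul1g.
Qed.

Lemma bpowzN1 k : bpowz (- 1 + k)%R = (ggen None)^-1 * bpowz k.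
Proof.
by rewrite -[in RHS](addKr (-1)%R k) opprK bpowzS mulgA mulVg mul1g.
Qed.

Lemma bpowzD k k' : bpowz (k + k')%R = bpowz k * bpowz k'.
Proof.
elim/int_rect: k => [|n IH|n IH].
- by rewrite add0r mul1g.
- by rewrite intS -addrA !bpowzS IH mulgA.
- by rewrite intS opprD -addrA !bpowzN1 IH mulgA.
Qed.

Lemma bpowz1 : bpowz 1%R = ggen None. Proof. by []. Qed.
Lemma bpowzN k : bpowz (- k)%R = (bpowz k)^-1.
Proof. by apply: (mulIg (bpowz k)); rewrite -bpowzD addNr mulVg. Qed.

Definition edge_elt (x : D * bool) : G :=
  if x.2 then ggen (Some x.1) else (ggen (Some x.1))^-1.

Lemma edge_elt_sinv x : edge_elt (sinv x) = (edge_elt x)^-1.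
Proof. by case: x => e [] //=; rewrite /edge_elt /= invgK. Qed.

Lemma cls_bpow k : cls (bpow D k) = bpowz (Posz k).
Proof.
elim: k => [//|k IH]; rewrite intS bpowzS -IH.
by rewrite [ggen _ * _]gmul_cls.
Qed.

Lemma cls_cat (u v : gword D) : cls (u ++ v) = cls u * cls v.
Proof. by rewrite -[RHS]/(gmul _ _) gmul_cls. Qed.

Lemma bpowz_gen (e : D) : bpowz (Posz (gn e)) * ggen (Some e) =
  ggen (Some e) * bpowz (edge_sign e * Posz (gm e))%R.
Proof.
have /cls_eqP := gcong_rel e; rewrite /rel_lhs /rel_rhs /edge_sign.
case: (is_pos e); lazy iota.
  by rewrite -[_ :: bpow _ _]cat1s !cls_cat !cls_bpow mul1r.
rewrite -[_ :: bpow _ _]cat1s !cls_cat !cls_bpow mulN1r => E.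
by apply: (mulIg (bpowz (gm e))); rewrite -!mulgA -bpowzD addNr mulg1.
Qed.

Lemma bpowz_intertwine (g : G) a c q :
  bpowz a * g = g * bpowz c -> bpowz (a * q)%R * g = g * bpowz (c * q)%R.
Proof.
move=> E; elim/int_rect: q => [|n IH|n IH].
- by rewrite !mulr0 mul1g mulg1.
- by rewrite intS !mulrDr !mulr1 !bpowzD mulgA -E -!mulgA IH.
- rewrite intS opprD !mulrDr !mulrN1 !bpowzD -!mulgA IH !mulgA; congr (_ * _).
  by rewrite !bpowzN; apply: (mulgI (bpowz a)); rewrite !mulgA mulgV mul1g E mulgK.
Qed.

Lemma bpowz_edge x q :
  bpowz (lweight x * q)%R * edge_elt x = edge_elt x * bpowz (rweight x * q)%R.
Proof.
apply: bpowz_intertwine; case: x => e []; rewrite /lweight /rweight /edge_elt /=.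
  exact: bpowz_gen.
have E : bpowz (edge_sign e * gm e)%R = (ggen (Some e))^-1 * bpowz (gn e) * ggen (Some e).
  by rewrite -mulgA bpowz_gen mulKg.
have {}E : bpowz (edge_sign e * gm e)%R * (ggen (Some e))^-1 =
    (ggen (Some e))^-1 * bpowz (gn e).
  by rewrite E mulgK.
have := bpowz_intertwine (edge_sign e) E; rewrite mulrAC edge_sign2 mul1r => ->.
by rewrite mulrC.
Qed.

Definition form_val (s : form) : G :=
  foldr (fun a g => bpowz a.1 * edge_elt a.2 * g) (bpowz s.2) s.1.

Lemma form_val_fpush k s : form_val (fpush k s) = bpowz k * form_val s.
Proof.
case: s => l j; rewrite /form_val /fpush /=.
elim: l k => [|[i x] l IH] k /=; first by rewrite bpowzD.
rewrite IH !mulgA; congr (_ * _).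
rewrite -[LHS]mulgA -bpowz_edge !mulgA -!bpowzD [(lweight x * _)%R]mulrC.
by rewrite [(modz _ _ + _)%R]addrC -divz_eq.
Qed.

Lemma form_val_fedge x s : form_val (fedge x s) = edge_elt x * form_val s.
Proof.
case: s => l j; rewrite /fedge /=; case: ifP => st; last by rewrite /form_val /= mul1g.
case: l st => [|[i y] l] //= /andP[/eqP -> /eqP ->].
by rewrite /form_val /= mul1g edge_elt_sinv mulVKg.
Qed.

Lemma form_val_act_letter a s : form_val (act_letter a s) = cls [:: a] * form_val s.
Proof.
case: a => [[e|] b]; rewrite /act_letter /=.
  rewrite form_val_fedge; congr (_ * _); case: b => //.
  apply: (mulIg (ggen (Some e))); rewrite /edge_elt mulVg -cls_cat.
  by apply/cls_eqP/gcong_sym; exact: (gcong_cancel _ false).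
rewrite form_val_fpush; congr (_ * _); case: b => //.
apply: (mulIg (ggen None)); rewrite (bpowzN 1) mulVg -cls_cat.
by apply/cls_eqP/gcong_sym; exact: (gcong_cancel _ false).
Qed.

(** Reading a form back as an element of [G] commutes with the action of each
    letter. Together with [form_valK] this gives the normal form theorem. *)
Lemma nfK g : form_val (nf g) = g.
Proof.
rewrite /nf -[RHS]cls_repr; elim: (repr g) => [//|a w IH] /=.
by rewrite form_val_act_letter IH -cls_cat.
Qed.

Lemma nf_bpowz_mul k g : nf (bpowz k * g) = fpush k (nf g).
Proof.
elim/int_rect: k => [|n IH|n IH].
- by rewrite mul1g fpush0 // nf_red.
- by rewrite intS bpowzS -mulgA nf_cls_mul IH fpushD.
- rewrite intS opprD bpowzN1 -mulgA fpushD -IH.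
  have -> : (ggen (None : gen D))^-1 = cls [:: (None, false)].
    have := form_val_act_letter (None, false) ([::], 0%R).
    by rewrite /act_letter form_val_fpush (_ : form_val _ = 1) // !mulg1 (bpowzN 1).
  by rewrite nf_cls_mul.
Qed.

Lemma nf_gen_mul e g : nf (ggen (Some e) * g) = fedge (e, true) (nf g).
Proof. by rewrite nf_cls_mul. Qed.

Definition posl (l : seq syl) : bool :=
  all (fun a => [&& a.2.2, (0 <= a.1)%R & (a.1 < lweight a.2)%R]) l.

Lemma posl_starts e l : posl l -> starts_inv (e, true) l = false.
Proof.
by case: l => [|[i [f s]] l] //= /andP[/andP[/= -> _] _]; rewrite xpair_eqE !andbF.
Qed.

Lemma posl_red l : posl l -> red l.
Proof.
elim: l => [|[i [e s]] l IH] //= /andP[/and3P[/= -> -> ->] pl] /=.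
by rewrite posl_starts // IH.
Qed.

Lemma form_valK l j : posl l -> nf (form_val (l, j)) = (l, j).
Proof.
elim: l => [|[i [e s]] l IH] pl.
  by rewrite -[form_val _]mulg1 nf_bpowz_mul nf1 /fpush /= addr0.
have /andP[/and3P[/= sT i0 il] pl'] := pl.
rewrite /form_val /= -/(form_val (l, j)) sT -mulgA nf_bpowz_mul /edge_elt /= nf_gen_mul IH //.
rewrite /fedge posl_starts // /fpush /= addr0 sT in il *.
rewrite divz_small ?i0 ?gtz0_abs ?lweight_gt0 // mulr0 push0 ?posl_red //=.
by rewrite add0r modz_small ?i0.
Qed.

Lemma push_posl k l : posl l -> posl (push k l).1.
Proof.
elim: l k => [|[i [e s]] l IH] //= k /andP[/and3P[/= -> _ _] pl].
by rewrite modz_ge0 ?lweight_neq0 // ltz_pmod ?lweight_gt0 // IH.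
Qed.

(** Elements whose normal form has no inverse edge. They form a submonoid
    containing [P] and all powers of [b], with a multiplication that is
    explicit on normal forms; divisibility in [P] is studied inside it. *)
Definition edge_pos (g : G) : bool := posl (nf g).1.

Lemma form_val_cat l1 j1 l2 j2 :
  form_val (l1, j1) * form_val (l2, j2) =
  form_val (l1 ++ (push j1 l2).1, ((push j1 l2).2 + j2)%R).
Proof.
have -> : form_val (l1, j1) * form_val (l2, j2) =
    foldr (fun a g => bpowz a.1 * edge_elt a.2 * g) (bpowz j1 * form_val (l2, j2)) l1.
  by rewrite {1}/form_val /=; elim: l1 => [//|a l IH] /=; rewrite -!mulgA IH.
by rewrite -form_val_fpush /form_val /= foldr_cat.
Qed.

(** On the left factor nothing cancels, so the product concatenates the forms
    after pushing the trailing power of [b] through the right factor. *)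
Lemma nf_mul g h : edge_pos g -> edge_pos h ->
  nf (g * h) = ((nf g).1 ++ (push (nf g).2 (nf h).1).1,
                ((push (nf g).2 (nf h).1).2 + (nf h).2)%R).
Proof.
rewrite /edge_pos => Qg Qh; rewrite -{1}(nfK g) -{1}(nfK h).
case: (nf g) Qg => l j /= Ql; case: (nf h) Qh => l' j' /= Ql'.
by rewrite form_val_cat form_valK // /posl all_cat; apply/andP; split => //; exact: push_posl.
Qed.

Lemma edge_posM g h : edge_pos g -> edge_pos h -> edge_pos (g * h).
Proof.
move=> Qg Qh; rewrite /edge_pos nf_mul // /posl all_cat; apply/andP; split => //.
exact: push_posl.
Qed.

Lemma edge_pos_val l j : posl l -> edge_pos (form_val (l, j)).
Proof. by move=> pl; rewrite /edge_pos form_valK. Qed.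

Lemma edge_pos_bpowz k : edge_pos (bpowz k). Proof. exact: (@edge_pos_val [::] k). Qed.

Lemma nf_bpowz k : nf (bpowz k) = ([::], k).
Proof. exact: (@form_valK [::] k). Qed.

Lemma nf_gen e : nf (ggen (Some e)) = ([:: (0%R, (e, true))], 0%R).
Proof. by rewrite -[ggen _]mulg1 nf_gen_mul nf1. Qed.

Definition edges (l : seq syl) : seq D := [seq a.2.1 | a <- l].

Lemma edges_push k l : edges (push k l).1 = edges l.
Proof. by elim: l k => [|[i x] l IH] k //=; rewrite IH. Qed.

Lemma edges_mul g h : edge_pos g -> edge_pos h ->
  edges (nf (g * h)).1 = edges (nf g).1 ++ edges (nf h).1.
Proof. by move=> Qg Qh; rewrite nf_mul // /edges map_cat -!/(edges _) edges_push. Qed.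

Definition allpos (l : seq syl) : bool := all (fun e => is_pos e) (edges l).

Lemma push_ge0 k l : posl l -> allpos l -> (0 <= k)%R -> (0 <= (push k l).2)%R.
Proof.
elim: l k => [|[i [e s]] l IH] k //= /andP[/and3P[/= -> i0 _] pl].
rewrite /allpos /= => /andP[pe ap] k0; apply: IH => //.
rewrite mulr_ge0 //; first by rewrite /rweight /edge_sign /= pe mul1r ltW ?lweight_gt0.
by rewrite divz_ge0 ?lweight_gt0 // addr_ge0.
Qed.

(** The condition which singles out the normal forms of elements of [P]: a
    negative trailing power of [b] can be absorbed by an edge of [A_-]
    standing further left, and by nothing else. *)
Definition Pform (s : form) : bool := [&& posl s.1 & allpos s.1 ==> (0 <= s.2)%R].

Lemma Pform_mul g h : Pform (nf g) -> Pform (nf h) -> Pform (nf (g * h)).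
Proof.
move=> /andP[Qg Pg] /andP[Qh Ph]; rewrite /Pform -/(edge_pos (g * h)) edge_posM //=.
rewrite /allpos edges_mul // all_cat nf_mul //=; apply/implyP => /andP[ag ah].
apply: addr_ge0; last exact: (implyP Ph).
by apply: push_ge0 => //; exact: (implyP Pg).
Qed.

Lemma Pset_Pform g : Pset g -> Pform (nf g).
Proof.
move=> Pg; apply: (Pg [set g : G | Pform (nf g)]); split.
  split; first by rewrite /= nf1.
  by move=> ? ? /=; exact: Pform_mul.
move=> _ [[e|] _ <-] /=; last by rewrite -bpowz1 nf_bpowz.
by rewrite nf_gen /Pform /= lweight_gt0 /= implybT.
Qed.

Lemma Pset_bpowz k : (0 <= k)%R -> Pset (bpowz k).
Proof.
case: k => // k _; elim: k => [|k IH]; first exact: Pset1.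
by rewrite intS bpowzS; apply: PsetM => //; exact: Pset_gen.
Qed.

Lemma Pset_bpowzW g k k' : Pset (bpowz k * g) -> (k <= k')%R -> Pset (bpowz k' * g).
Proof.
move=> Pg kk; rewrite -(subrK k k') bpowzD -mulgA; apply: PsetM => //.
by apply: Pset_bpowz; rewrite subr_ge0.
Qed.

Lemma gm_gt0 (e : D) : (0 < Posz (gm e))%R. Proof. by rewrite ltz_nat gm_ge1. Qed.

Lemma bpowz_gen_mul (e : D) q : bpowz (Posz (gn e) * q)%R * ggen (Some e) =
  ggen (Some e) * bpowz (edge_sign e * Posz (gm e) * q)%R.
Proof. exact: (bpowz_edge (e, true)). Qed.

(** Powers of [b] pass an edge of [A_+] with a positive factor, so that a
    large power on the left compensates any negative trailing power. *)
Lemma Pset_allpos_large l j : posl l -> allpos l ->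
  exists2 q : int, (0 <= q)%R & Pset (bpowz q * form_val (l, j)).
Proof.
elim: l => [|[i [e s]] l IH] /=.
  move=> _ _; exists `|j|%R; rewrite ?normr_ge0 // -[form_val _]/(bpowz j) -bpowzD.
  apply: Pset_bpowz; lia.
move=> /andP[/and3P[/= -> i0 _] pl]; rewrite /allpos /= => /andP[pe ap].
have [q q0 Pq] := IH pl ap; exists (Posz (gn e) * q)%R.
  by rewrite mulr_ge0.
rewrite /form_val /= -/(form_val (l, j)) !mulgA -bpowzD addrC bpowzD -!mulgA.
apply: PsetM; first exact: Pset_bpowz.
rewrite mulgA /edge_elt /= bpowz_gen_mul /edge_sign pe mul1r -mulgA.
apply: PsetM; first exact: Pset_gen.
apply: Pset_bpowzW Pq _; rewrite ler_peMl //; have := gm_gt0 e; lia.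
Qed.

(** For the last edge [e] of [A_-], [e = b^(n q) e b^(m q)] turns powers of
    [b] on the left into powers on the right of [e], and only edges of [A_+]
    remain to be passed. *)
Lemma Pset_neg l j : posl l -> ~~ allpos l -> Pset (form_val (l, j)).
Proof.
elim: l => [|[i [e s]] l IH] //= /andP[/and3P[/= -> i0 _] pl].
rewrite /allpos /= negb_and -/(allpos l); case: (boolP (allpos l)) => [ap|nap _]; last first.
  rewrite /form_val /=; apply: PsetM; last exact: IH.
  by apply: PsetM; [exact: Pset_bpowz|exact: Pset_gen].
rewrite /= orbF => ne.
have [q q0 Pq] := Pset_allpos_large j pl ap.
rewrite /form_val /= -/(form_val (l, j)) -mulgA.
have -> : edge_elt (e, true) * form_val (l, j) = bpowz (Posz (gn e) * q)%R * ggen (Some e) *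
    (bpowz (Posz (gm e) * q)%R * form_val (l, j)).
  rewrite bpowz_gen_mul !mulgA -(mulgA (ggen _)) -bpowzD /edge_sign (negbTE ne).
  by rewrite mulN1r mulNr addNr mulg1.
apply: PsetM; first exact: Pset_bpowz.
apply: PsetM.
  apply: PsetM; last exact: Pset_gen.
  by apply: Pset_bpowz; rewrite mulr_ge0.
by apply: Pset_bpowzW Pq _; rewrite ler_peMl //; have := gm_gt0 e; lia.
Qed.

Lemma Pset_nonneg l j : posl l -> (0 <= j)%R -> Pset (form_val (l, j)).
Proof.
move=> + j0; elim: l => [|[i [e s]] l IH] /=; first by move=> _; exact: Pset_bpowz.
move=> /andP[/and3P[/= -> i0 _] pl]; rewrite /form_val /=.
by apply: PsetM; [apply: PsetM; [exact: Pset_bpowz|exact: Pset_gen]|exact: IH].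
Qed.

Lemma PsetE g : Pset g <-> Pform (nf g).
Proof.
split; first exact: Pset_Pform.
have := nfK g; case: (nf g) => l j /= <- /andP[/= pl].
by case: (boolP (allpos l)) => ap /= j0; [exact: Pset_nonneg|exact: Pset_neg].
Qed.

Lemma Pset_edge_pos g : Pset g -> edge_pos g.
Proof. by move=> /PsetE /andP[]. Qed.

(** Some power of [b] conveys [g] into [P]; higher powers then do so too, by
    [Pset_bpowzW]. *)
Lemma edge_pos_large g : edge_pos g -> exists2 q : int, (0 <= q)%R & Pset (bpowz q * g).
Proof.
rewrite /edge_pos; have := nfK g; case: (nf g) => l j /= <- pl.
case: (boolP (allpos l)) => ap; first exact: Pset_allpos_large.
by exists 0%R => //; rewrite mul1g; exact: Pset_neg.
Qed.

(** The source of all least common multiples. If [g] is not in [P], its form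
    ends in [b^(-k)] with [k > 0] and has no edge of [A_-]; then [g y] lies in
    [P] exactly when [b^(-k) y] does, since both have the same trailing power
    of [b] and the same edges of [A_-]. *)
Lemma edge_pos_least g : edge_pos g -> exists k : nat, Pset (g * bpowz k) /\
  forall y, Pset y -> Pset (g * y) -> Pset (bpowz (- Posz k)%R * y).
Proof.
move=> Qg; have [Pg|nPg] := pselect (Pset g).
  by exists 0%N; rewrite mulg1; split => // y; rewrite mul1g.
have [ag jlt] : allpos (nf g).1 /\ ((nf g).2 < 0)%R.
  move/PsetE : nPg; rewrite /Pform -/(edge_pos g) Qg /= => /negP.
  by rewrite negb_imply ltNge => /andP.
exists `|(nf g).2|%N; have kE : (Posz `|(nf g).2| = - (nf g).2)%R by lia.
rewrite kE opprK; split.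
  apply/PsetE; rewrite nf_mul ?edge_pos_bpowz // nf_bpowz /= cats0 subrr /Pform /=.
  rewrite lexx implybT andbT.
  exact: Qg.
move=> y Py /PsetE Pgy; have Qy := Pset_edge_pos Py.
apply/PsetE; move: Pgy; rewrite /Pform -!/(edge_pos _) !edge_posM ?edge_pos_bpowz //=.
rewrite /allpos !edges_mul ?edge_pos_bpowz // all_cat -!/(allpos _) ag nf_bpowz /=.
by rewrite !nf_mul ?edge_pos_bpowz // nf_bpowz.
Qed.
End NormalForms.

(** * Divisibility in the monoid *)

Section Divisibility.
Variable D : gbs_data.
Local Notation G := (G D).
Local Notation P := (P D).
Implicit Types (p q x y z : P) (e : D).

Lemma Pval_inj : injective (@Pval D). Proof. exact: val_inj. Qed.

Lemma PvalM p q : Pval (p * q) = Pval p * Pval q. Proof. by []. Qed.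

Lemma Pset_Pval p : Pset (Pval p). Proof. exact: set_mem (Pvalp p). Qed.
Hint Resolve Pset_Pval : core.

Lemma edge_pos_Pval p : edge_pos (Pval p). Proof. exact: Pset_edge_pos. Qed.
Hint Resolve edge_pos_Pval : core.

Definition mkP (g : G) (Pg : Pset g) : P := MkP (mem_set Pg).

Local Notation b := (pb D).

Lemma Pval_bX k : Pval (b ^+ k) = bpowz D (Posz k).
Proof.
elim: k => [//|k IH]; rewrite expgS PvalM IH intS bpowzS; congr (_ * _).
Qed.

Lemma pidealP p x : pideal p x <-> exists y, x = p * y.
Proof. by split=> [[y _ <-]|[y ->]]; [exists y|exists y]. Qed.

Lemma pideal_Pset p x : pideal p x <-> Pset ((Pval p)^-1 * Pval x).
Proof.
split=> [/pidealP[y ->]|H]; first by rewrite PvalM mulKg.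
apply/pidealP; exists (mkP H); apply: Pval_inj; by rewrite PvalM /= mulVKg.
Qed.

Lemma pidealM p y : pideal p (p * y). Proof. by apply/pidealP; exists y. Qed.
Hint Resolve pidealM : core.

Lemma pideal_refl p : pideal p p.
Proof. by apply/pidealP; exists 1; rewrite mulg1. Qed.
Hint Resolve pideal_refl : core.

Lemma pideal1 p : pideal 1 p. Proof. by apply/pidealP; exists p; rewrite mul1g. Qed.

Lemma pideal_trans p q x : pideal p q -> pideal q x -> pideal p x.
Proof.
by move=> /pidealP[y ->] /pidealP[z ->]; rewrite -mulgA.
Qed.

Lemma pideal_sub p q : pideal p `<=` pideal q <-> pideal q p.
Proof. by split=> [/(_ p)|qp x]; [apply|exact: pideal_trans]. Qed.

Lemma pideal_mulWl p q x : pideal (p * q) x -> pideal p x.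
Proof. exact: pideal_trans. Qed.

Lemma pideal_mul2l p x y : pideal (p * x) (p * y) <-> pideal x y.
Proof. by rewrite !pideal_Pset !PvalM invgM -mulgA mulKg. Qed.

(** The vertex of [p] in the tree of cosets of [b^Z], given by the path from
    the root to it. *)
Definition vtx p : seq (syl D) := (nf (Pval p)).1.
Definition depth p : nat := size (vtx p).

Lemma size_push k (l : seq (syl D)) : size (push k l).1 = size l.
Proof. by rewrite -(size_map (fun a => a.2.1)) -/(edges _) edges_push size_map. Qed.

Lemma vtxM p q : prefix (vtx p) (vtx (p * q)).
Proof. by rewrite /vtx PvalM nf_mul //= prefix_prefix. Qed.

Lemma pideal_vtx p x : pideal p x -> prefix (vtx p) (vtx x).
Proof. by move=> /pidealP[y ->]; exact: vtxM. Qed.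

Lemma depthM p q : depth (p * q) = (depth p + depth q)%N.
Proof. by rewrite /depth /vtx PvalM nf_mul //= size_cat size_push. Qed.

Lemma depth_bX k : depth (b ^+ k) = 0%N.
Proof. by rewrite /depth /vtx Pval_bX nf_bpowz. Qed.

Lemma vtx_bX k : vtx (b ^+ k) = [::].
Proof. by rewrite /vtx Pval_bX nf_bpowz. Qed.

Lemma vtx_e e : vtx (pe e) = [:: (0%R, (e, true))].
Proof. by rewrite /vtx nf_gen. Qed.

Lemma depth_e e : depth (pe e) = 1%N. Proof. by rewrite /depth vtx_e. Qed.

Lemma depth1 : depth 1 = 0%N. Proof. exact: (depth_bX 0). Qed.

Lemma vtx_mulbX p k : vtx (p * b ^+ k) = vtx p.
Proof. by rewrite {1}/vtx PvalM nf_mul // -/(vtx (b ^+ k)) vtx_bX cats0. Qed.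

Lemma pideal_depth p x : pideal p x -> (depth p <= depth x)%N.
Proof. by move=> /pideal_vtx/size_prefix. Qed.

Lemma vtx_nil p : vtx p = [::] -> exists k, p = b ^+ k.
Proof.
rewrite /vtx => vp; have /andP[_] := Pset_Pform (Pset_Pval p).
move: (nfK (Pval p)); case: (nf (Pval p)) vp => l [k|k] /= -> pE // _.
by exists k; apply: Pval_inj; rewrite Pval_bX -pE.
Qed.

Lemma edge_pos_div (g h : G) : edge_pos g -> edge_pos h ->
  prefix (nf g).1 (nf h).1 -> edge_pos (g^-1 * h).
Proof.
rewrite /edge_pos => + + /prefixP[l' E]; move: (nfK g) (nfK h) E.
case: (nf g) => l j /=; case: (nf h) => _ j' /= <- <- -> pl.
rewrite {1}/posl all_cat => /andP[_ pl']; rewrite -/(edge_pos _).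
have -> : form_val (l ++ l', j') = form_val (l, 0%R) * form_val (l', j').
  by rewrite form_val_cat push0 ?posl_red //= add0r.
have -> : form_val (l, j) = form_val (l, 0%R) * bpowz D j.
  by rewrite -[bpowz D j]/(form_val ([::], j)) form_val_cat /= cats0 add0r.
rewrite invgM -mulgA mulKg -bpowzN; apply: edge_posM; first exact: edge_pos_bpowz.
exact: edge_pos_val.
Qed.

(** With [vtx p] a prefix of [vtx q], the quotient [p^-1 q] contains no
    inverse edge, and [edge_pos_least] yields the least [k] for which [q b^k]
    is a multiple of [p]. *)
Lemma lcm_prefix p q : prefix (vtx p) (vtx q) ->
  exists k, pideal p `&` pideal q = pideal (q * b ^+ k).
Proof.
move=> /(edge_pos_div (edge_pos_Pval p) (edge_pos_Pval q)) pq.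
have [k [Pk Pmin]] := edge_pos_least pq.
exists k; apply/seteqP; split=> [x [/pideal_Pset px /pidealP[y xE]]|x qx].
  move: px; rewrite xE PvalM mulgA => /(Pmin _ (Pset_Pval y)) Py.
  by apply/pideal_mul2l/pideal_Pset; rewrite Pval_bX -bpowzN.
split; last exact: pideal_mulWl qx.
by apply: pideal_trans qx; apply/pideal_Pset; rewrite PvalM Pval_bX mulgA.
Qed.

Lemma prefix_comp (T : eqType) (s1 s2 s : seq T) :
  prefix s1 s -> prefix s2 s -> (size s1 <= size s2)%N -> prefix s1 s2.
Proof.
rewrite !prefixE => /eqP E1 /eqP E2 le.
by rewrite -E2 take_takel // E1.
Qed.

(** Two elements with a common multiple have comparable paths, so comparing
    lengths suffices. *)
Lemma lcm_depth p q z : pideal p z -> pideal q z -> (depth p <= depth q)%N ->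
  exists k, pideal p `&` pideal q = pideal (q * b ^+ k).
Proof.
by move=> /pideal_vtx pz /pideal_vtx qz le; apply: lcm_prefix; exact: prefix_comp pz qz le.
Qed.

Lemma lcm_cases x p : pideal x `&` pideal p = set0 \/
  exists y, pideal x `&` pideal p = pideal (p * y).
Proof.
have [[z [xz pz]]|/nonemptyPn ->] := pselect (pideal x `&` pideal p !=set0); last by left.
right; have [le|/ltnW le] := leqP (depth x) (depth p).
  by have [k ->] := lcm_depth xz pz le; exists (b ^+ k).
have [k E] := lcm_depth pz xz le; rewrite setIC E.
have [/pidealP[y ->] _] : (pideal p `&` pideal x) (x * b ^+ k) by rewrite E.
by exists y.
Qed.

Lemma b_not_unit : ~ pideal b 1.
Proof.
move/pideal_Pset; rewrite mulg1 -[Pval b]/(Pval (b ^+ 1)) Pval_bX -bpowzN => /PsetE.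
by rewrite nf_bpowz.
Qed.

(** A power of [b] must be carried from right to left through an edge of
    [A_+], and [b] to the left of the edge costs at least one [b] to its
    right. *)
Lemma pos_edge_cancel_b e y : is_pos e -> pideal b (pe e * y) -> pideal b y.
Proof.
move=> pe_ /pideal_Pset; rewrite PvalM -[Pval b]/(Pval (b ^+ 1)) Pval_bX -bpowzN.
rewrite mulgA => H.
have Qg : edge_pos (bpowz D (-1)%R * Pval (pe e)) by rewrite edge_posM ?edge_pos_bpowz.
have [[|k] [Pk /(_ _ (Pset_Pval y) H) Pmin]] := edge_pos_least Qg; last first.
  apply/pideal_Pset; rewrite -[Pval b]/(Pval (b ^+ 1)) Pval_bX -bpowzN.
  by apply: Pset_bpowzW Pmin _; lia.
(* For [k = 0] the element [b^-1 e] would be in [P], but its form is [b^(n-1)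
    e b^-m]. *)
have : Pform (nf (bpowz D (-1)%R * Pval (pe e))) by apply/PsetE; rewrite mulg1 in Pk.
rewrite nf_bpowz_mul nf_gen /Pform /fpush /= /allpos /= pe_ /= => /andP[_].
rewrite !addr0 /rweight /edge_sign /= pe_ mul1r /lweight /=.
have -> : (-1 %/ gn e)%Z = (-1)%R.
  have n0 := gn_ge1 e.
  rewrite [in LHS](_ : -1 = -1 * Posz (gn e) + (Posz (gn e) - 1))%R; last by rewrite mulN1r; lia.
  by rewrite divzMDl ?divz_small ?addr0 //; lia.
by rewrite mulrN1 oppr_ge0 lez_nat leqNgt gm_ge1.
Qed.

(** Multiplication by [b^(-k)] on the left preserves the edges, and an edge of
    [A_-] relieves the trailing power of [b] of any condition. *)
Lemma neg_edge_pideal_bX y k : ~~ allpos (vtx y) -> pideal (b ^+ k) y.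
Proof.
move=> ny; apply/pideal_Pset; rewrite Pval_bX -bpowzN; apply/PsetE.
rewrite /Pform -/(edge_pos _) edge_posM ?edge_pos_bpowz //= /allpos.
by rewrite edges_mul ?edge_pos_bpowz // nf_bpowz /= -/(allpos _) (negbTE ny).
Qed.

Lemma pideal_bX_neg_edge e k y : ~~ is_pos e -> pideal (b ^+ k) (y * pe e).
Proof.
move=> ne; apply: neg_edge_pideal_bX; rewrite /allpos /vtx PvalM edges_mul // all_cat nf_gen /=.
by rewrite (negbTE ne) andbF.
Qed.

Lemma vtx_child e i : (i < gn e)%N -> vtx (b ^+ i * pe e) = [:: (Posz i, (e, true))].
Proof.
move=> ie; rewrite /vtx PvalM Pval_bX nf_bpowz_mul nf_gen /fpush /= addr0.
by rewrite modz_small // ltz_nat.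
Qed.

Lemma vtx_cons y a l : vtx y = a :: l ->
  exists e i, (i < gn e)%N /\ a = (Posz i, (e, true)).
Proof.
move=> vy; have := edge_pos_Pval y; rewrite /edge_pos -/(vtx y) vy /= => /andP[+ _].
case: a {vy} => [[i|i] [e s]] /=; last by rewrite andbF.
by rewrite ltz_nat => /andP[-> il]; exists e, i.
Qed.

(** Any step to a child of the root passes one of the elements [b^i e] with [i
    < n_e], but an edge of [A_-] may leave a negative power of [b], whence the
    correcting factor [b^k]. *)
Lemma child_below y a l : vtx y = a :: l ->
  exists e i k, (i < gn e)%N /\ pideal (b ^+ i * pe e) (y * b ^+ k).
Proof.
move=> vy; have [e [i [ie aE]]] := vtx_cons vy.
have [|k E] := @lcm_prefix (b ^+ i * pe e) y.
  by rewrite vtx_child // vy aE /= eqxx prefix0s.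
exists e, i, k; split => //.
by have [] : (pideal (b ^+ i * pe e) `&` pideal y) (y * b ^+ k) by rewrite E.
Qed.

(** In the absence of edges of [A_-] the trailing powers of [b] are
    non-negative, so no correction is needed. *)
Lemma child_below_allpos y a l : vtx y = a :: l -> allpos (vtx y) ->
  exists e i, [/\ is_pos e, (i < gn e)%N & pideal (b ^+ i * pe e) y].
Proof.
move=> vy ap; have [e [i [ie aE]]] := vtx_cons vy.
exists e, i; split => //; first by move: ap; rewrite vy aE /allpos /= => /andP[].
have := Pset_Pform (Pset_Pval y); rewrite /Pform -/(vtx y) ap /= => /andP[pl j0].
apply/pideal_Pset.
have -> : Pval y = bpowz D i * Pval (pe e) * form_val (l, (nf (Pval y)).2).
  by rewrite -{1}(nfK (Pval y)) [nf _]surjective_pairing -/(vtx y) vy aE.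
rewrite PvalM Pval_bX mulKg; apply: Pset_nonneg j0.
by move: pl; rewrite vy => /andP[].
Qed.

Lemma P_cases y : [\/ y = 1, pideal b y | exists2 e, is_pos e & pideal (pe e) y].
Proof.
case vy : (vtx y) => [|a l].
  have [[|k] ->] := vtx_nil vy; first by constructor 1.
  by constructor 2; rewrite expgS.
have [ap|nap] := boolP (allpos (vtx y)); last first.
  by constructor 2; exact: (neg_edge_pideal_bX 1 nap).
have [e [[|i] [pe_ _ iy]]] := child_below_allpos vy ap.
  by constructor 3; exists e => //; rewrite mul1g in iy.
by constructor 2; rewrite expgS -mulgA in iy; exact: pideal_mulWl iy.
Qed.

(** Moving [b^(n k)] through [e] leaves [b^(- m k)] in front of [y]; if the
    product is nevertheless a multiple of an [x] off the root, then [y] has to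
    make up for it and starts with [b] once [k] is large. *)
Lemma neg_edge_cancel_b e x : ~~ is_pos e -> vtx x <> [::] ->
  exists K, forall k y, (K <= k)%N ->
    pideal x (b ^+ (gn e * k) * pe e * y) -> pideal b y.
Proof.
move=> ne vx.
have vk k : vtx (b ^+ (gn e * k) * pe e) = [:: (0%R, (e, true))].
  rewrite /vtx PvalM Pval_bX nf_bpowz_mul nf_gen /fpush /= addr0.
  by rewrite PoszM mulrC modzMl.
case vxE : (vtx x) vx => [//|a l] _.
have [aE|aN] := pselect (a = (0%R, (e, true))); last first.
  exists 0%N => k y _ /pideal_vtx/(prefix_comp (vtxM (b ^+ (gn e * k) * pe e) y)).
  by rewrite vk vxE => /(_ isT) /= /andP[/eqP]; move/esym.
have pl : posl l by have := edge_pos_Pval x; rewrite /edge_pos -/(vtx x) vxE => /andP[].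
set x' := form_val (l, (nf (Pval x)).2).
have xE : Pval x = Pval (pe e) * x'.
  by rewrite -{1}(nfK (Pval x)) [nf _]surjective_pairing -/(vtx x) vxE aE /form_val /= mul1g.
have [q q0 Pq] : exists2 q, (0 <= q)%R & Pset (bpowz D q * (bpowz D (-1)%R * x')).
  by apply: edge_pos_large; rewrite edge_posM ?edge_pos_bpowz // edge_pos_val.
exists `|q|%N => k y kq /pidealP[z /(congr1 (@Pval D))].
rewrite !PvalM Pval_bX PoszM bpowz_gen_mul /edge_sign (negbTE ne) mulN1r mulNr xE -!mulgA.
move=> /mulgI yE.
apply/pideal_Pset; rewrite -[Pval b]/(Pval (b ^+ 1)) Pval_bX -bpowzN.
have -> : Pval y = bpowz D (Posz (gm e) * k)%R * (x' * Pval z).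
  by rewrite -yE mulgA -bpowzD subrr mul1g.
rewrite !mulgA -bpowzD addrC bpowzD; apply: PsetM => //; rewrite -mulgA.
apply: Pset_bpowzW Pq _.
have : (k <= gm e * k)%N by rewrite leq_pmull ?gm_ge1.
lia.
Qed.

Lemma P_ind (K : P -> Prop) : K 1 -> (forall (a : gen D) p, K p -> K (pgen a * p)) ->
  forall p, K p.
Proof.
move=> K1 KM p; rewrite -[p]mulg1; move: 1 K1.
pose S := [set g | exists2 q : P, Pval q = g & forall r, K r -> K (q * r)].
have [|q /Pval_inj <- //] := Pset_Pval p (_ : _ S).
split.
  split; first by exists 1 => // r; rewrite mul1g.
  move=> _ _ [q <- Kq] [r <- Kr]; exists (q * r) => // s Ks.
  by rewrite -mulgA; apply/Kq/Kr.
by move=> _ [a _ <-]; exists (pgen a) => // r; exact: KM.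
Qed.

(** The supports of the [theta_at] are finite, so the sums may be taken over a
    common finite set. *)
Lemma thetaM p q : theta (p * q) = (theta p + theta q)%N.
Proof.
pose S := fset_set ([set e | theta_at e p != 0%N] `|` [set e | theta_at e q != 0%N]).
have H r : (forall e, theta_at e r != 0%N -> theta_at e p != 0%N \/ theta_at e q != 0%N) ->
    theta r = (\sum_(e <- S) theta_at e r)%R.
  move=> h; apply: fsbigTE => e; rewrite in_fset_set; last first.
    by rewrite finite_setU; split; exact: theta_at_finite.
  apply: contraNeq => /h he; rewrite inE; exact: he.
rewrite !H; last 3 first.
- by right.
- by left.
- by move=> e; rewrite theta_atM addn_eq0 negb_and => /orP[]; [left|right].
rewrite -[RHS]/(_ + _)%R -big_split /=; apply: eq_bigr => e _; exact: theta_atM.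
Qed.

Lemma theta_depth p : theta p = depth p.
Proof.
have th0 q : (forall e, theta_at e q = 0%N) -> theta q = 0%N by move=> h; exact: fsbig1.
elim/P_ind: p => [|x p IH].
  rewrite depth1; apply: th0 => e.
  have /eqP := theta_atM e 1 1; rewrite mulg1 -{1}[theta_at e 1]addn0 eqn_add2l.
  by move=> /eqP.
rewrite thetaM depthM IH; congr (_ + _)%N; case: x => [e|].
  rewrite depth_e /theta -/(pe e) (@fsbigTE _ _ _ _ [fset e]%fset).
    by rewrite big_seq_fset1 theta_at_e eqxx.
  by move=> f; rewrite inE theta_at_e => /negbTE ->.
by rewrite -/(pb D) th0 ?(depth_bX 1) // => e; exact: theta_at_b.
Qed.

Lemma theta_prod (w : word D) i :
  (\sum_(k < i) theta (w k))%N = depth (\prod_(k < i) w k).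
Proof.
elim: i => [|i IH]; first by rewrite !big_ord0 depth1.
by rewrite !big_ord_recr /= depthM IH theta_depth.
Qed.
End Divisibility.

(** * Characters as filters *)

Section Characters.
Variable D : gbs_data.
Local Notation G := (G D).
Local Notation P := (P D).
Local Notation Omega := (Omega D).
Implicit Types (p q x y z : P) (e : D) (F : set P) (chi : Omega) (X : set Omega).
Local Notation b := (pb D).

Definition filt chi : set P := [set p | ev chi p].

(** Filters for divisibility. Characters correspond to them because [P] is
    right LCM. *)
Definition isfilt F := [/\ F !=set0,
  forall p x, F p -> pideal x p -> F x
  & forall p q, F p -> F q -> exists r, [/\ F r, pideal p r & pideal q r]].

Lemma J_cases (I : J D) : set_val I = set0 \/ exists p, I = J_of p.
Proof.
have [|[p Ip]] := set_valP I; first by left.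
by right; exists p; exact: val_inj.
Qed.

(** Directedness is where [chi (set0) = 0] is used: two ideals in the filter
    cannot be disjoint, hence meet in a principal ideal. *)
Lemma filt_isfilt chi : isfilt (filt chi).
Proof.
have /= [[I chiI] chiM chi0] := set_valP chi.
have evE x p : pideal x p -> ev chi p = ev chi p && ev chi x.
  move=> xp; apply: chiM; apply/esym/setIidPl; exact/pideal_sub.
split.
- have [I0|[p IE]] := J_cases I; first by have := chi0 _ I0; rewrite chiI.
  by exists p; rewrite /filt /= /ev -IE.
- by move=> p x; rewrite /filt /= => + /evE E; rewrite E => /andP[].
- move=> p q; rewrite /filt /= => pp qq.
  have [E|[y E]] := lcm_cases p q.
    have K0 : J D set0 by left.
    have := chiM (J_of p) (J_of q) (exist _ set0 (mem_set K0)) (esym E).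
    rewrite -!/(fn chi _) -!/(ev chi _) pp qq => h.
    by have := chi0 (exist _ set0 (mem_set K0)) erefl; rewrite -/(fn chi _) h.
  exists (q * y); split; last exact: pidealM.
    have := chiM (J_of p) (J_of q) (J_of (q * y)) (esym E).
    by rewrite -!/(fn chi _) -!/(ev chi _) pp qq.
  by have [] : (pideal p `&` pideal q) (q * y) by rewrite E; exact: pideal_refl.
Qed.

Lemma filt_up chi p x : filt chi p -> pideal x p -> filt chi x.
Proof. by have [_ up _] := filt_isfilt chi; exact: up. Qed.

Lemma filt_dir chi p q : filt chi p -> filt chi q ->
  exists r, [/\ filt chi r, pideal p r & pideal q r].
Proof. by have [_ _] := filt_isfilt chi; exact. Qed.

Lemma filt1 chi : filt chi 1.
Proof. have [[p pp] up _] := filt_isfilt chi; apply: up pp (pideal1 _). Qed.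

Lemma filt_meet chi p q r : filt chi p -> filt chi q ->
  pideal p `&` pideal q = pideal r -> filt chi r.
Proof.
move=> pp qq E; have [s [ss ps qs]] := filt_dir pp qq; apply: filt_up ss _.
by rewrite -E.
Qed.

Lemma filt_inj chi chi' : filt chi = filt chi' -> chi = chi'.
Proof.
move=> E; apply: val_inj; apply/funext => I.
have [I0|[p ->]] := J_cases I.
  by have /= [_ _ ->//] := set_valP chi; have /= [_ _ ->//] := set_valP chi'.
have : filt chi p <-> filt chi' p by rewrite E.
by rewrite /filt /= => H; apply/idP/idP => /H.
Qed.

Lemma filt_ex F : isfilt F -> exists chi, filt chi = F.
Proof.
move=> [[p0 Fp0] up dir].
pose f (I : J D) : bool := `[< exists2 p, F p & pideal p `<=` set_val I >].
have fO : Omega_set D f.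
  split.
  - by exists (J_of p0); apply/asboolP; exists p0.
  - move=> I I' K KE; apply/asboolP/andP => [[p Fp]|[/asboolP[p Fp pI] /asboolP[q Fq qI]]].
      by rewrite KE subsetI => -[? ?]; split; apply/asboolP; exists p.
    have [r [Fr pr qr]] := dir _ _ Fp Fq; exists r => //; rewrite KE subsetI.
    split; first by apply: subset_trans pI; exact/pideal_sub.
    by apply: subset_trans qI; exact/pideal_sub.
  - move=> I I0; apply/asboolP => -[p _]; rewrite I0 => /(_ p (pideal_refl p)); exact.
exists (exist _ f (mem_set fO)); apply/seteqP; split=> p; rewrite /filt /=.
  by move=> /asboolP[q Fq /pideal_sub]; exact: up.
by move=> Fp; apply/asboolP; exists p.
Qed.

(** The filter of [(p q^-1).chi], where [F] is the filter of [chi]. *)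
Definition transl p q F : set P := [set x | exists2 y, F (q * y) & pideal x (p * y)].

Lemma transl_isfilt p q chi : filt chi q -> isfilt (transl p q (filt chi)).
Proof.
move=> qq; split.
- by exists 1; exists 1; rewrite ?mulg1 //; exact: pideal1.
- by move=> r x [y Fy ry] xr; exists y => //; exact: pideal_trans ry.
- move=> r s [y Fy ry] [z Fz sz]; have [t [tt yt zt]] := filt_dir Fy Fz.
  have /pidealP[u tE] := pideal_mulWl yt.
  exists (p * u); split.
  + by exists u; rewrite -?tE //; exact: pideal_refl.
  + by apply: pideal_trans ry _; apply/pideal_mul2l/(pideal_mul2l q); rewrite -tE.
  + by apply: pideal_trans sz _; apply/pideal_mul2l/(pideal_mul2l q); rewrite -tE.
Qed.

(** The two clauses defining the partial action are the two cases of
    [lcm_cases]. *)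
Lemma actsP (g : G) chi chi' : acts g chi chi' <->
  exists p q, [/\ g = Pval p * (Pval q)^-1, filt chi q & filt chi' = transl p q (filt chi)].
Proof.
split=> [[p [q [gE qq H1 H0]]]|[p [q [gE qq E]]]]; exists p, q; split => //.
- apply/seteqP; split=> x.
    have [/H0|[y E]] := lcm_cases x p; first by rewrite /filt /= => ->.
    rewrite /filt /= (H1 _ _ E) => Fy; exists y => //.
    by have [] : (pideal x `&` pideal p) (p * y) by rewrite E; exact: pideal_refl.
  move=> [y Fy xpy]; have [E|[z E]] := lcm_cases x p.
    have : (pideal x `&` pideal p) (p * y) by split => //; exact: pidealM.
    by rewrite E.
  rewrite /filt /= (H1 _ _ E); apply: filt_up Fy _.
  apply/pideal_mul2l/(pideal_mul2l p); rewrite -E; split => //; exact: pidealM.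
- move=> x y xE; have fE : filt chi' x <-> transl p q (filt chi) x by rewrite E.
  apply/idP/idP => [/fE [z Fz xz]|Fy].
    apply: filt_up Fz _; apply/pideal_mul2l/(pideal_mul2l p); rewrite -xE; split => //.
    exact: pidealM.
  apply/fE; exists y => //.
  by have [] : (pideal x `&` pideal p) (p * y) by rewrite xE; exact: pideal_refl.
- move=> x x0; apply/negP => Fx; have [y Fy xy] : transl p q (filt chi) x by rewrite -E.
  have : (pideal x `&` pideal p) (p * y) by split => //; exact: pidealM.
  by rewrite x0.
Qed.

Lemma invariantP X : Defs.invariant X <->
  forall p q chi chi', X chi -> filt chi q -> filt chi' = transl p q (filt chi) -> X chi'.
Proof.
split=> [inv p q chi chi' Xchi qq E|H g chi chi' Xchi /actsP[p [q [gE qq E]]]].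
  by apply: (inv (Pval p * (Pval q)^-1) _ _ Xchi); apply/actsP; exists p, q.
exact: H E.
Qed.

Lemma ev_nbhs chi p : nbhs chi [set chi' | ev chi' p = ev chi p].
Proof.
exists (set_val @^-1` [set f : {ptws J D -> bool} | f (J_of p) = ev chi p]).
split => //; eexists; last by [].
have -> : [set f : {ptws J D -> bool} | f (J_of p) = ev chi p] =
    proj (J_of p) @^-1` [set ev chi p] by [].
by apply: open_comp => [f _|]; [exact: proj_continuous|exact: discrete_open].
Qed.

Lemma evs_nbhs chi (s : seq P) :
  nbhs chi [set chi' | forall x, x \in s -> ev chi' x = ev chi x].
Proof.
elim: s => [|x s IH]; first by apply: filterS filterT => chi' _ x.
apply: filterS2 (ev_nbhs chi x) IH => chi' h1 h2 y.
by rewrite inE => /orP[/eqP ->|]; [exact: h1|exact: h2].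
Qed.

(** The sets of characters agreeing with [chi] on a finite set generate a
    filter on [Omega]; it converges to [chi] coordinate by coordinate, hence
    is finer than the neighbourhoods of [chi]. *)
Lemma nbhs_evs chi (B : set Omega) : nbhs chi B ->
  exists s : seq P, forall chi', (forall x, x \in s -> ev chi' x = ev chi x) -> B chi'.
Proof.
pose C (s : seq P) := [set chi' | forall x, x \in s -> ev chi' x = ev chi x].
pose FF := filter_from [set: seq P] C.
have FFF : Filter FF.
  apply: filter_from_filter; first by exists [::].
  move=> s t _ _; exists (s ++ t) => // chi' h; split=> x xs; apply: h.
    by rewrite mem_cat xs.
  by rewrite mem_cat xs orbT.
have FFP : ((fun c : Omega => set_val c : {ptws J D -> bool}) @ FF) -->
    (set_val chi : {ptws J D -> bool}).
  apply/cvg_sup => I U [_ [[W oW <-] /= WI]] /filterS; apply.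
  rewrite /nbhs /=.
  have [I0|[p IE]] := J_cases I.
    exists [::] => // chi' _; move: WI; change (W (fn chi I) -> W (fn chi' I)).
    have /= [_ _ h] := set_valP chi; have /= [_ _ h'] := set_valP chi'.
    by have -> : fn chi' I = fn chi I by rewrite [LHS](h' _ I0) [RHS](h _ I0).
  exists [:: p] => // chi' h; move: WI; change (W (fn chi I) -> W (fn chi' I)).
  by have := h p; rewrite inE eqxx IE => /(_ isT); rewrite /ev => ->.
move=> [_ [[W oW <-] Wchi] WB].
have [|s _ h] := FFP W; first exact: open_nbhs_nbhs.
by exists s => chi' /h; exact: WB.
Qed.

Lemma closureP X chi : closure X chi <->
  forall s : seq P, exists2 chi', X chi' & forall x, x \in s -> ev chi' x = ev chi x.
Proof.
split=> [cl s|H B /nbhs_evs[s h]].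
  by have [chi' [? ?]] := cl _ (evs_nbhs chi s); exists chi'.
by have [chi' Xc ag] := H s; exists chi'; split => //; exact: h.
Qed.

Lemma closure_filtI X chi : (forall s : seq P, exists2 chi', X chi' &
    forall x, x \in s -> (filt chi' x <-> filt chi x)) -> closure X chi.
Proof.
move=> H; apply/closureP => s; have [chi' Xc h] := H s; exists chi' => // x /h.
by rewrite /filt /= => E; apply/idP/idP => /E.
Qed.

Lemma closure_filtE X chi (s : seq P) : closure X chi -> exists2 chi', X chi' &
    forall x, x \in s -> (filt chi' x <-> filt chi x).
Proof.
by move=> /closureP/(_ s)[chi' Xc h]; exists chi' => // x /h; rewrite /filt /= => ->.
Qed.
End Characters.

(** * The strata of the character space *)

Section Subspaces.
Variable D : gbs_data.
Local Notation G := (G D).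
Local Notation P := (P D).
Local Notation Omega := (Omega D).
Implicit Types (p q x y z : P) (e : D) (F : set P) (chi : Omega) (X : set Omega).
Local Notation b := (pb D).
Hint Resolve pidealM pideal_refl pideal1 : core.

Definition unbounded chi := forall N, exists2 p, filt chi p & (N <= depth p)%N.
Definition b_closed chi := forall p, filt chi p -> filt chi (p * b).
Definition principal p : set P := [set x | pideal x p].
(** The smallest [b]-stable filter containing [F]. That of [principal p]
    consists of the left divisors of the powers [p b^k]. *)
Definition b_hull F : set P := [set x | exists q k, F q /\ pideal x (q * b ^+ k)].

Lemma b_closedX chi p k : b_closed chi -> filt chi p -> filt chi (p * b ^+ k).
Proof.
move=> bc pp; elim: k => [|k IH]; first by rewrite mulg1.
by rewrite expgSr mulgA; exact: bc.
Qed.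

(** If [x] divides [z], then [x b^i] divides [z b^k] for large [k]: the paths
    are still comparable, and the least common multiple is of this form. *)
Lemma pideal_bX x z i : pideal x z -> exists k, pideal (x * b ^+ i) (z * b ^+ k).
Proof.
move=> /pideal_vtx; rewrite -(vtx_mulbX x i) => /lcm_prefix[k E]; exists k.
by have [] : (pideal (x * b ^+ i) `&` pideal z) (z * b ^+ k) by rewrite E.
Qed.

Lemma pideal_bXW x i j : (i <= j)%N -> pideal (x * b ^+ i) (x * b ^+ j).
Proof. by move=> /subnKC <-; rewrite expgnDr mulgA. Qed.

Lemma filt_lcm chi p q : filt chi p -> filt chi q -> (depth p <= depth q)%N ->
  exists2 k, pideal p `&` pideal q = pideal (q * b ^+ k) & filt chi (q * b ^+ k).
Proof.
move=> pp qq le; have [r [rr pr qr]] := filt_dir pp qq.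
by have [k E] := lcm_depth pr qr le; exists k => //; exact: filt_meet E.
Qed.

(** The elements [b^i] lie at the root, so they divide a suitable power [b^k];
    the quantification over [G] amounts to moving each [p] of the filter to
    the root. *)
Lemma Omega_bE : Omega_b_inf D = [set chi | b_closed chi].
Proof.
apply/seteqP; split=> [chi H p pp|chi bc g chi' /actsP[p [q [_ qq E]]] i].
  have [chi' E] := filt_ex (transl_isfilt 1 pp).
  have /actsP/H/(_ 1%N) : exists p' q', [/\ Pval 1 * (Pval p)^-1 = Pval p' * (Pval q')^-1,
      filt chi q' & filt chi' = transl p' q' (filt chi)] by exists 1, p.
  move=> h; have : filt chi' (b ^+ 1) by exact: h.
  rewrite E => -[y Fy]; rewrite mul1g => b_y.
  by apply: filt_up Fy _; exact/pideal_mul2l.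
rewrite -[is_true _]/(filt chi' _) E.
have [k bk] := pideal_bX i (pideal1 p); rewrite mul1g in bk.
by exists (b ^+ k) => //; exact: b_closedX.
Qed.

Lemma Omega_PP chi : Omega_P D chi <-> exists p, filt chi = principal p.
Proof.
split=> [[p H]|[p E]]; exists p.
  apply/seteqP; split=> x; first by move=> /H /pideal_sub.
  by move=> /pideal_sub /H.
move=> x; rewrite -[is_true _]/(filt chi x) E; split => [|/pideal_sub//].
by move=> ?; exact/pideal_sub.
Qed.

Lemma principal_isfilt p : isfilt (principal p).
Proof.
split; first by exists 1; exact: pideal1.
- by move=> q x qp xq; exact: pideal_trans qp.
- by move=> q r qp rp; exists p; split => //; exact: pideal_refl.
Qed.

Lemma b_hull_isfilt F : isfilt F -> isfilt (b_hull F).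
Proof.
move=> [[p0 Fp0] up dir]; split.
- by exists p0, p0, 0%N; rewrite mulg1.
- by move=> p x [q [k [Fq pq]]] xp; exists q, k; split => //; exact: pideal_trans pq.
- move=> p p' [q [k [Fq pq]]] [q' [k' [Fq' pq']]].
  have [r [Fr qr qr']] := dir _ _ Fq Fq'.
  have [c qc] := pideal_bX k qr; have [c' qc'] := pideal_bX k' qr'.
  exists (r * b ^+ (c + c')); split.
  + by exists r, (c + c')%N.
  + apply: pideal_trans pq _; apply: pideal_trans qc _; apply: pideal_bXW; exact: leq_addr.
  + apply: pideal_trans pq' _; apply: pideal_trans qc' _; apply: pideal_bXW; exact: leq_addl.
Qed.

Lemma sub_b_hull F : F `<=` b_hull F.
Proof. by move=> x Fx; exists x, 0%N; rewrite mulg1. Qed.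

Lemma b_hull_closed chi F : filt chi = b_hull F -> b_closed chi.
Proof.
move=> E p; rewrite E => -[q [k [Fq pq]]].
have [c pc] := pideal_bX 1 pq; exists q, (k + c)%N; split => //.
by rewrite expgnDr mulgA.
Qed.

Lemma b_hull_principalE p : b_hull (principal p) = [set x | exists k, pideal x (p * b ^+ k)].
Proof.
apply/seteqP; split=> x.
  move=> [q [k [qp xq]]]; have [c qc] := pideal_bX k qp; exists c.
  exact: pideal_trans qc.
by move=> [k xk]; exists p, k; split => //; exact: pideal_refl.
Qed.

(** Choose [p] in the filter with a longest path. Every [q] in the filter then
    divides some [p b^k] in the filter, and the two cases are whether [k] is
    bounded. *)
Lemma not_unboundedP chi : ~ unbounded chi ->
  (exists p, filt chi = principal p) \/ (exists p, filt chi = b_hull (principal p)).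
Proof.
move=> nu.
have [p pp pmax] : exists2 p, filt chi p & forall q, filt chi q -> (depth q <= depth p)%N.
  apply: contrapT => H; apply: nu; elim=> [|N [p pp Np]].
    by exists 1 => //; exact: filt1.
  apply: contrapT => H'; apply: H; exists p => // q qq.
  rewrite leqNgt; apply/negP => pq; apply: H'; exists q => //; exact: leq_ltn_trans pq.
have cof q : filt chi q -> exists2 k, filt chi (p * b ^+ k) & pideal q (p * b ^+ k).
  move=> qq; have [k E pk] := filt_lcm qq pp (pmax _ qq); exists k => //.
  by have [] : (pideal q `&` pideal p) (p * b ^+ k) by rewrite E; exact: pideal_refl.
have [all|nall] := pselect (forall k, filt chi (p * b ^+ k)).
  right; exists p; rewrite b_hull_principalE; apply/seteqP; split=> x.
    by move=> /cof[k _ xk]; exists k.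
  by move=> [k xk]; exact: filt_up xk.
left; have /existsNP[k0 nk0] := nall.
have [k pk nk] : exists2 k, filt chi (p * b ^+ k) & ~ filt chi (p * b ^+ k.+1).
  apply: contrapT => H; apply: nk0; elim: k0 => [|k IH]; first by rewrite mulg1.
  by apply: contrapT => H'; apply: H; exists k.
exists (p * b ^+ k); apply/seteqP; split=> x; last by move=> xk; exact: filt_up xk.
move=> /cof[j pj xj]; apply: pideal_trans xj _; apply: pideal_bXW.
rewrite leqNgt; apply/negP => kj; apply: nk; apply: filt_up pj _; exact: pideal_bXW.
Qed.

Lemma principal_not_b_closed chi p : filt chi = principal p -> ~ b_closed chi.
Proof.
move=> E /(_ p); rewrite E => /(_ (pideal_refl p)); rewrite /principal /= -{2}[p]mulg1.
by move=> /pideal_mul2l/b_not_unit.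
Qed.

Lemma principal_not_unbounded chi p : filt chi = principal p -> ~ unbounded chi.
Proof. by move=> E /(_ (depth p).+1)[q]; rewrite E => /pideal_depth; lia. Qed.

Lemma b_hull_principal_not_unbounded chi p : filt chi = b_hull (principal p) -> ~ unbounded chi.
Proof.
move=> E /(_ (depth p).+1)[q]; rewrite E b_hull_principalE => -[k /pideal_depth].
by rewrite depthM depth_bX; lia.
Qed.

(** Elements of [P] are represented by words over a countable alphabet. *)
Lemma P_enum : exists f : nat -> P, forall p, exists n, f n = p.
Proof.
pose W : countType := seq (option D * bool).
pose f n : P := if @choice.unpickle W n is Some w then
  if pselect (Pset (cls (w : gword D))) is left H then mkP H else 1 else 1.
exists f => p; exists (@choice.pickle W (repr (Pval p))).
rewrite /f choice.pickleK; case: pselect => [H|]; first by apply: Pval_inj; rewrite /= cls_repr.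
by rewrite cls_repr => /(_ (Pset_Pval p)).
Qed.

(** [theta] is the length of the path. Conversely an unbounded filter is
    countable and directed, so it has a cofinal chain of divisors, whose
    successive quotients are the letters of the word. *)
Lemma Omega_AE : Omega_A_inf D = [set chi | unbounded chi].
Proof.
apply/seteqP; split=> [chi [w wchi winf] N|chi un].
  have [i] := winf N; rewrite theta_prod => Ni; exists (\prod_(k < i) w k) => //.
  by apply/wchi; exists i.
have [f fs] := P_enum.
have step (np : nat * P) : exists s, filt chi np.2 ->
    filt chi (np.2 * s) /\ (filt chi (f np.1) -> pideal (f np.1) (np.2 * s)).
  case: np => n p /=.
  have [pp|] := pselect (filt chi p); last by exists 1.
  have [fn|nfn] := pselect (filt chi (f n)); last by exists 1 => _; rewrite mulg1.
  have [r [rr fr /pidealP[s sE]]] := filt_dir fn pp.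
  by exists s; rewrite -sE.
have [st stP] := choice step.
(* [acc n] lies in the filter and is a multiple of those among [f 0, f 1, ...,
    f (n - 1)] that do. *)
pose acc := fix acc n : P := if n is m.+1 then acc m * st (m, acc m) else 1.
pose w n := st (n, acc n).
have accE i : \prod_(k < i) w k = acc i.
  by elim: i => [|i IH]; rewrite ?big_ord0 // big_ord_recr IH.
have accF i : filt chi (acc i).
  by elim: i => [|i IH]; [exact: filt1|exact: (stP (i, acc i) IH).1].
have wchi : is_chi_word w chi.
  move=> p; rewrite -[is_true _]/(filt chi p); split=> [pp|[i]]; rewrite ?accE; last first.
    by move=> pi; exact: filt_up (accF i) pi.
  have [n pE] := fs p; exists n.+1; rewrite accE -pE.
  by apply: (stP (n, acc n) (accF n)).2; rewrite /= pE.
exists w => // N; have [p pp Np] := un N; have /wchi[i pi] := pp; exists i.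
by rewrite theta_prod; apply: leq_trans Np _; exact: pideal_depth.
Qed.

(** The partial action of [p q^-1] is undone by that of [q p^-1], so that a
    stratum stable under translation has a stable complement. *)
Lemma translK p q chi : filt chi q -> transl q p (transl p q (filt chi)) = filt chi.
Proof.
move=> qq; apply/seteqP; split=> x.
  move=> [y [z Fz /pideal_mul2l yz] xy]; apply: filt_up Fz _.
  by apply: pideal_trans xy _; exact/pideal_mul2l.
move=> xx; have [r [rr xr /pidealP[y yE]]] := filt_dir xx qq.
by exists y; [exists y; rewrite -?yE|rewrite -yE].
Qed.

Lemma unbounded_transl chi chi' p q : unbounded chi -> filt chi q ->
  filt chi' = transl p q (filt chi) -> unbounded chi'.
Proof.
move=> un qq E N; have [r rr Nr] := un (depth q + N)%N.
have [s [ss rs /pidealP[y yE]]] := filt_dir rr qq.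
exists (p * y); first by rewrite E; exists y => //; rewrite -yE.
have := pideal_depth rs; rewrite yE !depthM; lia.
Qed.

Lemma b_closed_transl chi chi' p q : b_closed chi -> filt chi q ->
  filt chi' = transl p q (filt chi) -> b_closed chi'.
Proof.
move=> bc qq E x; rewrite E => -[y Fy xy]; have [k xk] := pideal_bX 1 xy.
by exists (y * b ^+ k); rewrite mulgA //; exact: b_closedX.
Qed.

Lemma principal_transl chi chi' p q r : filt chi = principal r -> filt chi q ->
  filt chi' = transl p q (filt chi) -> exists r', filt chi' = principal r'.
Proof.
move=> ->; rewrite {1}/principal /= => /pidealP[r' ->] ->; exists (p * r').
apply/seteqP; split=> x; last by move=> xr; exists r' => //; exact: pideal_refl.
move=> [y /pideal_mul2l yr xy]; apply: pideal_trans xy _; exact/pideal_mul2l.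
Qed.

Lemma invariant_A : Defs.invariant (Omega_A_inf D).
Proof. by rewrite Omega_AE; apply/invariantP => p q chi chi'; exact: unbounded_transl. Qed.

Lemma invariant_b : Defs.invariant (Omega_b_inf D).
Proof. by rewrite Omega_bE; apply/invariantP => p q chi chi'; exact: b_closed_transl. Qed.

Lemma invariant_inf : Defs.invariant (Omega_inf D).
Proof.
apply/invariantP => p q chi chi' nP qq E /Omega_PP[r Er]; apply/nP/Omega_PP.
apply: (principal_transl (p := q) (q := p) Er).
  by rewrite E; exists 1; rewrite ?mulg1.
by rewrite E translK.
Qed.

Lemma invariantI X Y : Defs.invariant X -> Defs.invariant Y -> Defs.invariant (X `&` Y).
Proof. by move=> hX hY g chi chi' [? ?] a; split; [apply: hX a|apply: hY a]. Qed.

Lemma translate X p chi : Defs.invariant X -> X chi ->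
  exists2 chi', X chi' & forall x, filt chi' x <-> exists2 y, filt chi y & pideal x (p * y).
Proof.
move=> /invariantP inv Xc; have [chi' E] := filt_ex (transl_isfilt p (filt1 chi)).
exists chi'; first exact: inv Xc (filt1 chi) E.
by move=> x; rewrite E; split=> -[y Fy xy]; exists y; rewrite ?mul1g // in Fy *.
Qed.

Lemma pullback X q chi : Defs.invariant X -> X chi -> filt chi q ->
  exists2 chi', X chi' & forall x, filt chi' x <-> filt chi (q * x).
Proof.
move=> /invariantP inv Xc qq; have [chi' E] := filt_ex (transl_isfilt 1 qq).
exists chi'; first exact: inv Xc qq E.
move=> x; rewrite E; split=> [[y Fy]|Fx]; last by exists x; rewrite ?mul1g.
by rewrite mul1g => xy; apply: filt_up Fy _; exact/pideal_mul2l.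
Qed.

Lemma fn_sub chi chi' : ([set I | fn chi I] `<=` [set I | fn chi' I]) <->
  filt chi `<=` filt chi'.
Proof.
split=> [H p|H I]; first exact: H.
have [I0|[p ->]] := J_cases I; last exact: H.
by have /= [_ _ h] := set_valP chi; rewrite /= [fn _ _](h _ I0).
Qed.

Lemma Omega_maxP chi : Omega_max D chi <->
  forall chi', filt chi `<=` filt chi' -> filt chi' `<=` filt chi.
Proof.
split=> H chi'.
  by move=> /fn_sub/H E; apply/fn_sub; rewrite E.
by move=> /[dup] s /fn_sub/H/fn_sub s'; apply/seteqP.
Qed.

(** A maximal filter contains its [b]-hull, and it cannot be bounded because
    the hull of [p] is contained in that of [p e]. Conversely a filter
    containing an unbounded [b]-stable one consists of divisors of elements [p
    b^k] of the latter. *)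
Lemma Omega_maxE : Omega_max D = [set chi | b_closed chi /\ unbounded chi].
Proof.
apply/seteqP; split=> [chi /Omega_maxP mx|chi [bc un]]; last first.
  apply/Omega_maxP => chi' sub x xx.
  have [p pp xp] := un (depth x).
  have [k E _] := filt_lcm xx (sub _ pp) xp.
  apply: filt_up (b_closedX k bc pp) _.
  by have [] : (pideal x `&` pideal p) (p * b ^+ k) by rewrite E.
have bc : b_closed chi.
  have [chi' E] := filt_ex (b_hull_isfilt (filt_isfilt chi)).
  have sub : filt chi `<=` filt chi' by rewrite E; exact: sub_b_hull.
  by move=> p /sub/(b_hull_closed E)/mx; apply; exact: sub.
split => //; apply: contrapT => /not_unboundedP[[p E]|[p E]].
  exact: principal_not_b_closed E bc.
have [e] := edge_inhabited D.
have [chi' E'] := filt_ex (b_hull_isfilt (principal_isfilt (p * pe e))).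
have /mx/(_ (p * pe e)) : filt chi `<=` filt chi'.
  rewrite E E' !b_hull_principalE => x [k xk].
  have [c kc] := pideal_bX k (pidealM p (pe e)); exists c; exact: pideal_trans kc.
rewrite E E' => /(_ (@sub_b_hull (principal _) _ (pideal_refl _))).
rewrite b_hull_principalE => -[k].
by move=> /pideal_depth; rewrite !depthM depth_bX depth_e; lia.
Qed.

Lemma pe_chain_isfilt e : isfilt [set x | exists n, pideal x (pe e ^+ n)].
Proof.
split.
- by exists 1, 0%N.
- by move=> p x [n pn] xp; exists n; exact: pideal_trans pn.
- move=> p q [n pn] [m qm]; exists (pe e ^+ (n + m)); split.
  + by exists (n + m)%N.
  + by apply: pideal_trans pn _; rewrite expgnDr.
  + by apply: pideal_trans qm _; rewrite addnC expgnDr.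
Qed.

Lemma depth_eX e n : depth (pe e ^+ n) = n.
Proof.
elim: n => [|n IH]; first exact: depth1.
by rewrite expgS depthM IH depth_e.
Qed.

Lemma exists_max : exists2 chi, b_closed chi & unbounded chi.
Proof.
have [e] := edge_inhabited D.
have [chi E] := filt_ex (b_hull_isfilt (pe_chain_isfilt e)).
exists chi; first exact: b_hull_closed E.
move=> N; exists (pe e ^+ N); last by rewrite depth_eX.
by rewrite E; apply: sub_b_hull; exists N.
Qed.

(** The divisors of the powers of [e]. None of these powers is a multiple of
    [b], by [pos_edge_cancel_b]. *)
Lemma exists_unbounded_not_b_closed e : is_pos e -> exists2 chi, unbounded chi & ~ b_closed chi.
Proof.
move=> pe_; have [chi E] := filt_ex (pe_chain_isfilt e); exists chi.
  by move=> N; exists (pe e ^+ N); rewrite ?depth_eX // E; exists N.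
move=> /(_ 1 (filt1 _)); rewrite mul1g E => -[n].
elim: n => [|n IH]; first exact: b_not_unit.
by rewrite expgS => /(pos_edge_cancel_b pe_).
Qed.

Lemma exists_b_closed_not_unbounded : exists2 chi, b_closed chi & ~ unbounded chi.
Proof.
have [chi E] := filt_ex (b_hull_isfilt (principal_isfilt 1)); exists chi.
  exact: b_hull_closed E.
exact: b_hull_principal_not_unbounded E.
Qed.

Lemma exists_principal p : exists chi, filt chi = principal p.
Proof. exact: filt_ex (principal_isfilt p). Qed.
End Subspaces.

(** * Closed invariant subspaces *)

Section Classification.
Variable D : gbs_data.
Local Notation P := (P D).
Local Notation Omega := (Omega D).
Implicit Types (p q x y z : P) (e : D) (F : set P) (chi : Omega) (X : set Omega).
Local Notation b := (pb D).
Hint Resolve pidealM pideal_refl pideal1 : core.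

Lemma common_bound chi (s : seq P) p0 : filt chi p0 -> exists r,
  [/\ filt chi r, pideal p0 r & forall x, x \in s -> filt chi x -> pideal x r].
Proof.
move=> p00; elim: s => [|x s [r [rr pr H]]]; first by exists p0.
have [xx|nx] := pselect (filt chi x); last first.
  by exists r; split => // y; rewrite inE => /orP[/eqP ->|/H].
have [t [tt xt rt]] := filt_dir xx rr; exists t; split => //.
  exact: pideal_trans rt.
by move=> y; rewrite inE => /orP[/eqP -> //|/H h /h yr]; exact: pideal_trans rt.
Qed.

Lemma deep_element chi (s : seq P) : unbounded chi ->
  exists2 p, filt chi p & forall x, x \in s -> (depth x <= depth p)%N.
Proof.
move=> un; elim: s => [|x s [p pp H]]; first by exists 1 => //; exact: filt1.
have [q qq xq] := un (depth x + depth p)%N; exists q => // y.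
rewrite inE => /orP[/eqP ->|/H]; lia.
Qed.

Lemma fresh_edge (S : set D) (s : seq P) : infinite_set S ->
  exists2 e, S e & forall x, x \in s -> e \notin edges (vtx x).
Proof.
move=> Sinf; apply: contrapT => H; apply: Sinf.
apply: (@sub_finite_set _ _ [set` flatten [seq edges (vtx x) | x <- s]]); last first.
  exact: finite_seq.
move=> e Se; apply: contrapT => /= he; apply: H; exists e => // x xs.
apply/negP => ex; apply: he; apply/flattenP; exists (edges (vtx x)) => //.
exact: map_f.
Qed.

Section InX.
Variables (X : set Omega) (Xcl : closed X) (Xinv : Defs.invariant X).

(** Approximate [chi] by [r.alpha], with [r] in the filter of [chi] a multiple
    of the given elements of this filter, and with a longer path than all
    given elements. If a given [x] belongs to [r.alpha], it divides some [r
    b^k], which lies in [chi]. *)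
Lemma max_in alpha chi : X alpha -> b_closed chi -> unbounded chi -> X chi.
Proof.
move=> Xa bc un; apply: Xcl; apply: closure_filtI => s.
have [p0 pp ps] := deep_element s un; have [r [rr pr rs]] := common_bound s pp.
have [chi' Xc E] := translate r Xinv Xa; exists chi' => // x xs; split.
  move=> /E[y _ xry]; have [k Ek] := lcm_depth xry (pidealM r y)
    (leq_trans (ps _ xs) (pideal_depth pr)).
  apply: filt_up (b_closedX k bc rr) _.
  by have [] : (pideal x `&` pideal r) (r * b ^+ k) by rewrite Ek.
by move=> xx; apply/E; exists 1; [exact: filt1|rewrite mulg1; exact: rs].
Qed.

(** Every filter is the limit of the principal filters of its elements. *)
Lemma principal_dense alpha p : X alpha -> filt alpha = principal p -> X = setT.
Proof.
move=> Xa aE; apply/seteqP; split=> // chi _; apply: Xcl; apply: closure_filtI => s.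
have pp : filt alpha p by rewrite aE; exact: pideal_refl.
have [a1 Xa1 E1] := pullback Xinv Xa pp.
have [r [rr _ rs]] := common_bound s (filt1 chi).
have [chi' Xc E] := translate r Xinv Xa1; exists chi' => // x xs; split.
  move=> /E[y /E1]; rewrite aE /principal /= -{2}[p]mulg1 => /pideal_mul2l y1 xry.
  apply: filt_up rr _; apply: pideal_trans xry _.
  by rewrite -{2}[r]mulg1; exact/pideal_mul2l.
by move=> xx; apply/E; exists 1; [exact: filt1|rewrite mulg1; exact: rs].
Qed.

Lemma exists_without_b alpha : X alpha -> ~ b_closed alpha -> exists2 a0, X a0 & ~ filt a0 b.
Proof.
move=> Xa nb; have [p pp npb] : exists2 p, filt alpha p & ~ filt alpha (p * b).
  by apply: contrapT => H; apply: nb => p pp; apply: contrapT => h; apply: H; exists p.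
by have [a0 Xa0 E] := pullback Xinv Xa pp; exists a0 => // /E.
Qed.

(** Let [r b^c] be the least common multiple of [r] and a given [x] with a
    shorter path. If [x] is in [r.alpha], then [c > 0] would put [b] in
    [alpha]; if [x] is in [chi], then [c > 0] would put [r b] in [chi]. In
    both cases [x] divides [r], which lies in both filters. *)
Lemma not_b_closed_in alpha chi : X alpha -> ~ b_closed alpha ->
  unbounded chi -> ~ b_closed chi -> X chi.
Proof.
move=> Xa nba un nb; have [a0 Xa0 nb0] := exists_without_b Xa nba.
apply: Xcl; apply: closure_filtI => s.
have [p0 pp ps] := deep_element s un.
have [p pp' npb] : exists2 p, filt chi p & ~ filt chi (p * b).
  by apply: contrapT => H; apply: nb => p p'; apply: contrapT => h; apply: H; exists p.
have [q [qq p0q pq]] := filt_dir pp pp'.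
(* The largest power of [b] after [q]: not all occur, since [p b] divides one
    of them. *)
have [k qk nqk] : exists2 k, filt chi (q * b ^+ k) & ~ filt chi (q * b ^+ k.+1).
  apply: contrapT => H.
  have all k : filt chi (q * b ^+ k).
    elim: k => [|k IH]; first by rewrite mulg1.
    by apply: contrapT => h; apply: H; exists k.
  have [k pk] := pideal_bX 1 pq; apply: npb; exact: filt_up (all k) pk.
set r := q * b ^+ k in qk.
have rb : ~ filt chi (r * b) by rewrite /r -mulgA -expgSr.
have dr x : x \in s -> (depth x <= depth r)%N.
  move=> /ps h; apply: leq_trans h _; apply: pideal_depth; exact: pideal_trans p0q (pidealM _ _).
have [chi' Xc E] := translate r Xinv Xa0; exists chi' => // x xs; split.
  move=> /E[y ay xry]; have [[|c] Ec] := lcm_depth xry (pidealM r y) (dr _ xs).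
    apply: filt_up qk _; rewrite mulg1 in Ec.
    by have [] : (pideal x `&` pideal r) r by rewrite Ec.
  case: nb0; apply: filt_up ay _.
  have : (pideal x `&` pideal r) (r * y) by split.
  by rewrite Ec => /pideal_mul2l; rewrite expgS => /pideal_mulWl.
move=> xx; apply/E; exists 1; [exact: filt1|rewrite mulg1].
have [[|c] Ec rc] := filt_lcm xx qk (dr _ xs).
  by rewrite mulg1 in Ec; have [] : (pideal x `&` pideal r) r by rewrite Ec.
by case: rb; apply: filt_up rc _; rewrite expgS mulgA.
Qed.

Lemma b_closed_bounded_in alpha chi : X alpha -> b_closed alpha -> ~ unbounded alpha ->
  b_closed chi -> ~ unbounded chi -> X chi.
Proof.
move=> Xa bca nua bc nu.
have [[p /principal_not_b_closed/(_ bca)//]|[p aE]] := not_unboundedP nua.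
have [[q /principal_not_b_closed/(_ bc)//]|[q cE]] := not_unboundedP nu.
have pp : filt alpha p by rewrite aE; apply: sub_b_hull; exact: pideal_refl.
have [a1 Xa1 E1] := pullback Xinv Xa pp.
have [chi' Xc E] := translate q Xinv Xa1; suff -> : chi = chi' by [].
apply: filt_inj; rewrite cE b_hull_principalE; apply/seteqP; split=> x.
  move=> [k xk]; apply/E; exists (b ^+ k) => //; apply/E1.
  by rewrite aE b_hull_principalE; exists k.
move=> /E[y /E1]; rewrite aE b_hull_principalE => -[k /pideal_mul2l yk] xqy.
by exists k; apply: pideal_trans xqy _; exact/pideal_mul2l.
Qed.

(** With [e] in [A_-] and [alpha] omitting [b], the translates of [alpha] by
    [b^(n k) e] tend to the filter of all powers of [b]: these powers divide
    [e], and by [neg_edge_cancel_b] no element off the root survives in the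
    limit. *)
Lemma neg_edge_b_closed_bounded_in alpha e : X alpha -> ~ b_closed alpha -> ~~ is_pos e ->
  exists2 chi, X chi & b_closed chi /\ ~ unbounded chi.
Proof.
move=> Xa nba ne; have [a0 Xa0 nb0] := exists_without_b Xa nba.
have [chi E] := filt_ex (b_hull_isfilt (principal_isfilt (1 : P))).
exists chi; last by split; [exact: b_hull_closed E|exact: b_hull_principal_not_unbounded E].
apply: Xcl; apply: closure_filtI => s.
(* One exponent serves for all elements of [s] off the root. *)
have [K HK] : exists K, forall x, x \in s -> vtx x <> [::] -> forall y,
    pideal x (b ^+ (gn e * K) * pe e * y) -> pideal b y.
  suff [K HK] : exists K, forall x, x \in s -> vtx x <> [::] -> forall k y, (K <= k)%N ->
    pideal x (b ^+ (gn e * k) * pe e * y) -> pideal b y.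
    by exists K => x xs vx y; apply: HK vx _ _ _.
  elim: s => [|x s [K HK]]; first by exists 0%N.
  have [vx|vx] := pselect (vtx x = [::]).
    by exists K => y; rewrite inE => /orP[/eqP ->|]; [rewrite vx|exact: HK].
  have [K' HK'] := neg_edge_cancel_b ne vx.
  exists (K + K')%N => y; rewrite inE => /orP[/eqP ->|ys] vy k z kk.
    by apply: HK'; apply: leq_trans kk; exact: leq_addl.
  by apply: (HK y ys vy); apply: leq_trans kk; exact: leq_addr.
have [chi' Xc E'] := translate (b ^+ (gn e * K) * pe e) Xinv Xa0.
exists chi' => // x xs; rewrite E b_hull_principalE; split.
  move=> /E'[y ay xy]; have [vx|vx] := pselect (vtx x = [::]); last first.
    by case: nb0; apply: filt_up ay _; exact: HK xs vx _ xy.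
  by have [k ->] := vtx_nil vx; exists k; rewrite mul1g.
move=> [k xk]; apply/E'; exists 1; first exact: filt1.
rewrite mulg1; apply: pideal_trans xk _; rewrite mul1g; exact: pideal_bX_neg_edge.
Qed.

(** If [alpha] omits [b], its translates by distinct edges of [A_+] tend to
    the principal filter of 1: an element of the translate by [e] off the root
    involves [e], and one at the root is not a multiple of [b]. *)
Lemma infinite_pos_setT alpha : X alpha -> ~ b_closed alpha -> infinite_set (Apos D) ->
  X = setT.
Proof.
move=> Xa nba Ainf; have [a0 Xa0 nb0] := exists_without_b Xa nba.
have [chi E] := exists_principal (1 : P).
apply: (@principal_dense chi 1) => //; apply: Xcl; apply: closure_filtI => s.
have [e pe_ es] := fresh_edge s Ainf.
have [chi' Xc E'] := translate (pe e) Xinv Xa0.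
exists chi' => // x xs; rewrite E; split; last first.
  move=> x1; apply/E'; exists 1; first exact: filt1.
  exact: pideal_trans x1 (pideal1 _).
move=> /E'[y ay xy]; case vx : (vtx x) => [|a l].
  have [[|k] xE] := vtx_nil vx; first by rewrite /principal /= xE.
  case: nb0; apply: filt_up ay _; apply: (pos_edge_cancel_b pe_).
  by move: xy; rewrite xE expgS => /pideal_mulWl.
have := prefix_comp (vtxM (pe e) y) (pideal_vtx xy); rewrite vtx_e vx => /(_ isT).
move=> /= /andP[/eqP aE _]; have := es _ xs; rewrite vx -aE /= inE eqxx.
by [].
Qed.

End InX.

Lemma closed_b : closed (Omega_b_inf D).
Proof.
rewrite Omega_bE => chi cl p pp.
have [chi' bc ag] := closure_filtE [:: p; p * b] cl.
by apply/ag; rewrite ?inE ?eqxx ?orbT //; apply: bc; apply/ag; rewrite ?inE ?eqxx.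
Qed.

Lemma not_unbounded_top chi : ~ unbounded chi ->
  exists2 p, filt chi p & forall q, filt chi q -> (depth q <= depth p)%N.
Proof.
move=> /not_unboundedP[[p E]|[p E]]; exists p; rewrite E.
- exact: pideal_refl.
- by move=> q /pideal_depth.
- by apply: sub_b_hull; exact: pideal_refl.
- by move=> q; rewrite b_hull_principalE => -[k /pideal_depth]; rewrite depthM depth_bX addn0.
Qed.

(** The elements that a filter containing [p] has to meet in order to have
    longer paths, up to powers of [b]. *)
Definition children (r : seq D) p : seq P :=
  [seq p * (b ^+ i * pe e) | e <- r, i <- iota 0 (gn e)].

Lemma mem_children r p e i : e \in r -> (i < gn e)%N ->
  p * (b ^+ i * pe e) \in children r p.
Proof.
move=> er ie; apply: (@allpairs_f_dep _ (fun=> nat) _ (fun e i => p * (b ^+ i * pe e))) => //.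
by rewrite mem_iota.
Qed.

Lemma finite_seq_ex (S : set D) : finite_set S -> exists r : seq D, forall e, S e -> e \in r.
Proof. by move=> /finite_seqP[r ->]; exists r. Qed.

Lemma unbounded_below chi p : unbounded chi -> filt chi p ->
  exists y a l, filt chi (p * y) /\ vtx y = a :: l.
Proof.
move=> un pp; have [q qq pq] := un (depth p).+1.
have [r [rr qr /pidealP[y yE]]] := filt_dir qq pp.
have : (0 < depth y)%N by have := pideal_depth qr; rewrite yE depthM; lia.
rewrite /depth; case vy : (vtx y) => [//|a l] _.
by exists y, a, l; rewrite -yE.
Qed.

(** A limit of maximal filters with a longest path at [p] would omit the
    finitely many [children] of [p], but a maximal filter containing [p]
    contains one of them. *)
Lemma closed_max : finite_set [set: D] -> closed (Omega_max D).
Proof.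
rewrite Omega_maxE => /finite_seq_ex[r rP] chi cl.
have bc : b_closed chi.
  have := closed_b; rewrite Omega_bE; apply.
  by move: chi cl; apply: closureS => chi [].
split => //; apply: contrapT => /not_unbounded_top[p pp top].
have [chi' [bc' un'] ag] := closure_filtE (p :: children r p) cl.
have pp' : filt chi' p by apply/ag => //; rewrite inE eqxx.
have [y [a [l [py vy]]]] := unbounded_below un' pp'.
have [e [i [k [ie iy]]]] := child_below vy.
have : filt chi (p * (b ^+ i * pe e)).
  apply/ag; first by rewrite inE mem_children ?orbT // rP.
  apply: filt_up (b_closedX k bc' py) _; rewrite -mulgA; exact/pideal_mul2l.
by move=> /top; rewrite !depthM depth_e; lia.
Qed.

(** As for [closed_max]; in the absence of edges of [A_-], unbounded filters
    contain one of the [children] without being [b]-stable. *)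
Lemma closed_A : Aneg D = set0 -> finite_set (Apos D) -> closed (Omega_A_inf D).
Proof.
rewrite Omega_AE => A0 /finite_seq_ex[r rP] chi cl.
apply: contrapT => /not_unbounded_top[p pp top].
have [chi' un' ag] := closure_filtE (p :: children r p) cl.
have pp' : filt chi' p by apply/ag => //; rewrite inE eqxx.
have [y [a [l [py vy]]]] := unbounded_below un' pp'.
have ap : allpos (vtx y).
  apply/allP => e _; apply/negPn/negP => ne.
  have : Aneg D e by exact/negP.
  by rewrite A0.
have [e [i [pe_ ie iy]]] := child_below_allpos vy ap.
have : filt chi (p * (b ^+ i * pe e)).
  apply/ag; first by rewrite inE mem_children ?orbT // rP.
  apply: filt_up py _; exact/pideal_mul2l.
by move=> /top; rewrite !depthM depth_e; lia.
Qed.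

(** A principal filter is isolated: besides [p] itself, the multiples of [p]
    are multiples of [p b] or of one of the finitely many [p e] with [e] in
    [A_+], because each edge of [A_-] is a multiple of [b]. *)
Lemma closed_inf : finite_set (Apos D) -> closed (Omega_inf D).
Proof.
move=> /finite_seq_ex[r rP] chi cl /Omega_PP[p E].
have [chi' np ag] := closure_filtE (p :: p * b :: [seq p * pe e | e <- r]) cl.
apply/np/Omega_PP; exists p.
have pp' : filt chi' p by apply/ag; rewrite ?inE ?eqxx // E; exact: pideal_refl.
apply/seteqP; split=> x; last by move=> xp; exact: filt_up xp.
move=> xx; have [s [ss xs /pidealP[y yE]]] := filt_dir xx pp'.
have nchild z : p * z \in p :: p * b :: [seq p * pe e | e <- r] ->
    pideal z y -> pideal z 1.
  move=> zs zy; have : filt chi (p * z).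
    by apply/ag => //; apply: filt_up ss _; rewrite yE; exact/pideal_mul2l.
  by rewrite E /principal /= -{2}[p]mulg1 => /pideal_mul2l.
have [y1|by_|[e pe_ ey]] := P_cases y.
- by rewrite yE y1 mulg1 in xs.
- by case: (@b_not_unit D); apply: nchild by_; rewrite !inE eqxx orbT.
- have /pideal_depth : pideal (pe e) 1.
    by apply: nchild ey; rewrite !inE (map_f (fun e => p * pe e)) ?orbT // rP.
  by rewrite depth_e depth1.
Qed.

Lemma invariant_max : Defs.invariant (Omega_max D).
Proof.
have -> : Omega_max D = Omega_b_inf D `&` Omega_A_inf D.
  by rewrite Omega_maxE Omega_bE Omega_AE.
exact: invariantI (@invariant_b D) (@invariant_A D).
Qed.

Lemma boundary_finite : finite_set [set: D] -> boundary D = Omega_max D.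
Proof. by move=> fin; apply/esym/closure_id/closed_max. Qed.

(** The [b]-hull of [p] is the limit of maximal filters through [p e], for [e]
    running through infinitely many edges. *)
Lemma boundary_infinite : infinite_set [set: D] -> boundary D = Omega_b_inf D.
Proof.
move=> Ainf; apply/seteqP; split.
  move=> chi cl; apply: closed_b; move: chi cl; apply: closureS => chi.
  by rewrite Omega_maxE Omega_bE => -[].
move=> chi; rewrite Omega_bE => bc.
have [un|nu] := pselect (unbounded chi).
  by apply: subset_closure; rewrite Omega_maxE.
have [[p /principal_not_b_closed/(_ bc)//]|[p cE]] := not_unboundedP nu.
apply: closure_filtI => s; have [e _ es] := fresh_edge s Ainf.
have [tau bt ut] := exists_max D.
have [|chi' mx E] := translate (p * pe e) invariant_max (_ : Omega_max D tau).
  by rewrite Omega_maxE.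
exists chi' => // x xs; rewrite cE b_hull_principalE; split.
  move=> /E[y _ xy]; have [xp|px] := leqP (depth x) (depth p).
    have [|k Ek] := lcm_depth xy (_ : pideal p _) xp; first by rewrite -mulgA.
    by exists k; have [] : (pideal x `&` pideal p) (p * b ^+ k) by rewrite Ek.
  have : prefix (vtx (p * pe e)) (vtx x).
    apply: prefix_comp (vtxM _ y) (pideal_vtx xy) _.
    by rewrite -/(depth _) depthM depth_e addn1.
  move=> /prefixP[t xE]; have := es _ xs.
  rewrite xE /edges map_cat mem_cat -/(edges _) /vtx PvalM edges_mul ?edge_pos_Pval //.
  by rewrite nf_gen mem_cat /= inE eqxx orbT.
move=> [k xk]; apply: filt_up xk; apply: b_closedX.
  by move: mx; rewrite Omega_maxE => -[].
by apply/E; exists 1; [exact: filt1|rewrite -mulgA].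
Qed.

Lemma inf_cases chi : Omega_inf D chi <-> unbounded chi \/ b_closed chi.
Proof.
split=> [np|[un|bc] /Omega_PP[p E]].
- have [|nu] := pselect (unbounded chi); first by left.
  have [[p E]|[p E]] := not_unboundedP nu; first by case: np; apply/Omega_PP; exists p.
  by right; exact: b_hull_closed E.
- exact: principal_not_unbounded E un.
- exact: principal_not_b_closed E bc.
Qed.

(** [X] is determined by whether it meets the principal stratum, the stratum
    of unbounded filters that are not [b]-stable, and the bounded [b]-stable
    one. *)
Lemma classify X : closed_invariant_subspaces D X ->
  [\/ X = Omega_max D, X = Omega_A_inf D, X = Omega_b_inf D | X = Omega_inf D \/ X = setT].
Proof.
move=> [[alpha Xa] Xcl Xinv].
have Xmax chi : b_closed chi -> unbounded chi -> X chi := max_in Xcl Xinv Xa.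
have [[a Xa' /Omega_PP[p E]]|noP] := pselect (exists2 a, X a & Omega_P D a).
  by constructor 4; right; exact: principal_dense Xa' E.
have {noP} Xinf chi : X chi -> unbounded chi \/ b_closed chi.
  by move=> Xc; apply/inf_cases => Pc; apply: noP; exists chi.
have [hA|nA] := pselect (exists2 a, X a & ~ b_closed a); last first.
  have Xb chi : X chi -> b_closed chi.
    by move=> Xc; apply: contrapT => nb; apply: nA; exists chi.
  have [[c Xc nu]|nB] := pselect (exists2 a, X a & ~ unbounded a).
    constructor 3; rewrite Omega_bE; apply/seteqP; split=> chi; first exact: Xb.
    move=> bc; have [un|nun] := pselect (unbounded chi); first exact: Xmax.
    exact: b_closed_bounded_in Xc (Xb _ Xc) nu bc nun.
  constructor 1; rewrite Omega_maxE; apply/seteqP; split=> chi => [Xc|[]]; last exact: Xmax.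
  by split; [exact: Xb|apply: contrapT => nu; apply: nB; exists chi].
have {hA} XA chi : unbounded chi -> X chi.
  have [a Xa' nb] := hA => un; have [bc|nbc] := pselect (b_closed chi); first exact: Xmax.
  exact: not_b_closed_in Xa' nb un nbc.
have [[c Xc nu]|nB] := pselect (exists2 a, X a & ~ unbounded a).
  constructor 4; left; apply/seteqP; split=> chi; first by move=> /Xinf/inf_cases.
  move=> /inf_cases h; have [/XA//|nun] := pselect (unbounded chi).
  by apply: (b_closed_bounded_in Xinv Xc _ nu _ nun); [case: (Xinf _ Xc)|case: h].
constructor 2; rewrite Omega_AE; apply/seteqP; split=> chi; last exact: XA.
by move=> Xc; apply: contrapT => nu; apply: nB; exists chi.
Qed.

(** Below any [p] in an unbounded filter there is an edge, which lies in [A_-]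
    and so releases a [b]. *)
Lemma no_pos_b_closed chi : Apos D = set0 -> unbounded chi -> b_closed chi.
Proof.
move=> A0 un p pp; have [y [a [l [py vy]]]] := unbounded_below un pp.
apply: filt_up py _; apply/pideal_mul2l; apply: (neg_edge_pideal_bX 1).
have [e [i [_ aE]]] := vtx_cons vy; rewrite vy aE /allpos /= negb_and.
by apply/orP; left; apply/negP => pe_; have : Apos D e by []; rewrite A0.
Qed.

Lemma closed_invariant_b : closed_invariant_subspaces D (Omega_b_inf D).
Proof.
split; [|exact: closed_b|exact: invariant_b].
by have [chi bc _] := exists_max D; exists chi; rewrite Omega_bE.
Qed.

Lemma closed_invariant_boundary : closed_invariant_subspaces D (boundary D).
Proof.
have [fin|infin] := pselect (finite_set [set: D]); last first.
  by rewrite boundary_infinite //; exact: closed_invariant_b.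
split; [|exact: closed_closure|by rewrite boundary_finite //; exact: invariant_max].
by have [chi bc un] := exists_max D; exists chi; rewrite boundary_finite // Omega_maxE.
Qed.

Lemma closed_invariant_inf : finite_set (Apos D) -> closed_invariant_subspaces D (Omega_inf D).
Proof.
move=> fin; split; [|exact: closed_inf|exact: invariant_inf].
by have [chi bc _] := exists_max D; exists chi; apply/inf_cases; right.
Qed.

Lemma closed_invariant_A : Aneg D = set0 -> finite_set (Apos D) ->
  closed_invariant_subspaces D (Omega_A_inf D).
Proof.
move=> A0 fin; split; [|exact: closed_A|exact: invariant_A].
by have [chi _ un] := exists_max D; exists chi; rewrite Omega_AE.
Qed.

Lemma closed_invariant_setT : closed_invariant_subspaces D setT.
Proof. by split; [have [chi _ _] := exists_max D; exists chi|exact: closedT|]. Qed.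

Lemma max_sub_A : Omega_max D `<=` Omega_A_inf D.
Proof. by rewrite Omega_maxE Omega_AE => chi []. Qed.
Lemma max_sub_b : Omega_max D `<=` Omega_b_inf D.
Proof. by rewrite Omega_maxE Omega_bE => chi []. Qed.
Lemma A_sub_inf : Omega_A_inf D `<=` Omega_inf D.
Proof. by rewrite Omega_AE => chi un; apply/inf_cases; left. Qed.
Lemma b_sub_inf : Omega_b_inf D `<=` Omega_inf D.
Proof. by rewrite Omega_bE => chi un; apply/inf_cases; right. Qed.

Lemma inf_proper : Omega_inf D `<` setT.
Proof.
split=> // H; have [chi E] := exists_principal (1 : P).
by case: (H chi I); apply/Omega_PP; exists 1.
Qed.

Lemma b_proper : Omega_b_inf D `<` setT.
Proof.
split=> // H; have [_ ni] := inf_proper; apply: ni.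
exact: subset_trans H b_sub_inf.
Qed.

Lemma b_not_sub_A : ~ (Omega_b_inf D `<=` Omega_A_inf D).
Proof.
rewrite Omega_AE Omega_bE => H; have [chi bc nu] := exists_b_closed_not_unbounded D.
by apply: nu; exact: H.
Qed.

Lemma A_not_sub_b e : is_pos e -> ~ (Omega_A_inf D `<=` Omega_b_inf D).
Proof.
move=> pe_; rewrite Omega_AE Omega_bE => H; have [chi un nb] := exists_unbounded_not_b_closed pe_.
by apply: nb; exact: H.
Qed.

(** A filter that is not [b]-stable exists thanks to the edge of [A_+], and
    the edge of [A_-] then forces bounded filters into the closure of its
    orbit. *)
Lemma A_not_closed_invariant e e' : is_pos e -> ~~ is_pos e' ->
  ~ closed_invariant_subspaces D (Omega_A_inf D).
Proof.
move=> pe_ ne [_ Acl Ainv]; have [chi un nb] := exists_unbounded_not_b_closed pe_.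
have [|tau + [_ nu]] := neg_edge_b_closed_bounded_in Acl Ainv (_ : Omega_A_inf D chi) nb ne.
  by rewrite Omega_AE.
by rewrite Omega_AE.
Qed.

(** The boundary is then [Omega_b_inf], which contains bounded filters. *)
Lemma classify_infinite X : infinite_set [set: D] -> closed_invariant_subspaces D X ->
  X = Omega_b_inf D \/ X = Omega_inf D \/ X = setT.
Proof.
move=> infin XC; have bX : Omega_b_inf D `<=` X.
  rewrite -boundary_infinite // => chi; have [[a Xa] Xcl Xinv] := XC.
  move=> cl; apply: (Xcl); move: chi cl; apply: closureS => chi.
  by rewrite Omega_maxE => -[]; exact: (max_in Xcl Xinv Xa).
case: (classify XC) bX => [-> H|-> H|-> _|h _]; [| |by left|by right].
- by case: b_not_sub_A; apply: subset_trans H max_sub_A.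
- by case: b_not_sub_A.
Qed.
End Classification.

Theorem theorem5p17 (D : gbs_data) :
  (finite_set (Apos D) /\ Apos D !=set0 /\ Aneg D = set0 ->
     closed_invariant_subspaces D =
       [set boundary D; Omega_A_inf D; Omega_b_inf D; Omega_inf D; setT] /\
     boundary D `<` Omega_A_inf D /\ Omega_A_inf D `<` Omega_inf D /\
     Omega_inf D `<` setT /\
     boundary D `<` Omega_b_inf D /\ Omega_b_inf D `<` Omega_inf D /\
     ~ (Omega_A_inf D `<=` Omega_b_inf D) /\
     ~ (Omega_b_inf D `<=` Omega_A_inf D)) /\
  (Apos D = set0 /\ finite_set (Aneg D) /\ Aneg D !=set0 ->
     closed_invariant_subspaces D = [set boundary D; Omega_inf D; setT] /\
     boundary D = Omega_A_inf D /\ Omega_inf D = Omega_b_inf D /\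
     boundary D `<` Omega_inf D /\ Omega_inf D `<` setT) /\
  (finite_set (Apos D) /\ Apos D !=set0 /\
   finite_set (Aneg D) /\ Aneg D !=set0 ->
     closed_invariant_subspaces D =
       [set boundary D; Omega_b_inf D; Omega_inf D; setT] /\
     boundary D `<` Omega_b_inf D /\ Omega_b_inf D `<` Omega_inf D /\
     Omega_inf D `<` setT) /\
  (Apos D = set0 /\ infinite_set (Aneg D) ->
     closed_invariant_subspaces D = [set boundary D; setT] /\
     boundary D = Omega_b_inf D /\ Omega_b_inf D = Omega_inf D /\
     Omega_inf D `<` setT) /\
  (finite_set (Apos D) /\ Apos D !=set0 /\ infinite_set (Aneg D) ->
     closed_invariant_subspaces D = [set boundary D; Omega_inf D; setT] /\
     boundary D = Omega_b_inf D /\ Omega_b_inf D `<` Omega_inf D /\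
     Omega_inf D `<` setT) /\
  (infinite_set (Apos D) ->
     closed_invariant_subspaces D = [set boundary D; setT] /\
     boundary D = Omega_b_inf D /\ Omega_b_inf D `<` setT).
Proof.
have AU : [set: D] = Apos D `|` Aneg D by rewrite /Aneg setUv.
have finU : finite_set (Apos D) -> finite_set (Aneg D) -> finite_set [set: D].
  by move=> fp fn; rewrite AU finite_setU.
have infP : infinite_set (Apos D) -> infinite_set [set: D].
  by move=> ip /(sub_finite_set (@subsetT _ _)).
have infN : infinite_set (Aneg D) -> infinite_set [set: D].
  by move=> ip /(sub_finite_set (@subsetT _ _)).
have cib := @closed_invariant_b D; have ciT := @closed_invariant_setT D.
have cid := @closed_invariant_boundary D.
have infT := @inf_proper D.
have bpr (e : D) : is_pos e -> Omega_b_inf D `<` Omega_inf D.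
  move=> pe_; split; first exact: b_sub_inf.
  by move=> H; case: (A_not_sub_b pe_); exact: subset_trans (@A_sub_inf D) H.
have posE : Apos D = set0 -> Omega_A_inf D = Omega_max D /\ Omega_inf D = Omega_b_inf D.
  move=> A0; split; apply/seteqP; split.
  - by rewrite Omega_AE Omega_maxE => chi un; split => //; exact: no_pos_b_closed.
  - exact: max_sub_A.
  - by rewrite Omega_bE => chi /inf_cases[/(no_pos_b_closed A0)|].
  - exact: b_sub_inf.
split; [|split; [|split; [|split; [|split]]]].
- move=> [fp [[e pe_] n0]].
  have fU : finite_set [set: D] by apply: finU => //; rewrite n0; exact: finite_set0.
  have bd := boundary_finite fU.
  split; [|split; [|split; [|split; [|split; [|split; [|split]]]]]].
  + apply/seteqP; split=> X.
      move=> /classify[->|->|->|[->|->]]; rewrite -?bd.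
      * by do 4 left.
      * by do 3 left; right.
      * by do 2 left; right.
      * by left; right.
      * by right.
    case=> [[[[]|]|]|] -> //; [exact: closed_invariant_A|exact: closed_invariant_inf].
  + rewrite bd; split; first exact: max_sub_A.
    by move=> H; case: (A_not_sub_b pe_); apply: subset_trans H (@max_sub_b D).
  + split; first exact: A_sub_inf.
    by move=> H; case: (@b_not_sub_A D); exact: subset_trans (@b_sub_inf D) H.
  + exact: infT.
  + rewrite bd; split; first exact: max_sub_b.
    by move=> H; case: (@b_not_sub_A D); apply: subset_trans H (@max_sub_A D).
  + exact: bpr pe_.
  + exact: A_not_sub_b pe_.
  + exact: b_not_sub_A.
- move=> [p0 [fn [e ne]]].
  have fp : finite_set (Apos D) by rewrite p0; exact: finite_set0.
  have bd := boundary_finite (finU fp fn); have [AE iE] := posE p0.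
  split; [|split; [|split; [|split]]] => //.
  + apply/seteqP; split=> X.
      move=> /classify[->|->|->|[->|->]]; rewrite -?iE ?AE -?bd.
      * by do 2 left.
      * by do 2 left.
      * by left; right.
      * by left; right.
      * by right.
    by case=> [[]|] -> //; exact: closed_invariant_inf.
  + by rewrite AE.
  + rewrite bd iE; split; first exact: max_sub_b.
    by move=> H; case: (@b_not_sub_A D); apply: subset_trans H (@max_sub_A D).
- move=> [fp [[e pe_] [fn [e' ne]]]].
  have bd := boundary_finite (finU fp fn).
  split; [|split; [|split]] => //; last exact: bpr pe_.
  + apply/seteqP; split=> X.
      move=> /[dup] /classify[->|->|->|[->|->]] XC; rewrite -?bd.
      * by do 3 left.
      * by case: (A_not_closed_invariant pe_ (introN idP ne) XC).
      * by do 2 left; right.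
      * by left; right.
      * by right.
    by case=> [[[]|]|] -> //; exact: closed_invariant_inf.
  + rewrite bd; split; first exact: max_sub_b.
    by move=> H; case: (@b_not_sub_A D); apply: subset_trans H (@max_sub_A D).
- move=> [p0 infn]; have bd := boundary_infinite (infN infn); have [_ iE] := posE p0.
  split; [|split; [|split]] => //.
  apply/seteqP; split=> X; last by case=> ->.
  by move=> /(classify_infinite (infN infn))[->|[->|->]]; rewrite ?iE -?bd; [left|left|right].
- move=> [fp [[e pe_] infn]]; have bd := boundary_infinite (infN infn).
  split; [|split; [|split]] => //; last exact: bpr pe_.
  apply/seteqP; split=> X; last by case=> [[]|] -> //; exact: closed_invariant_inf.
  move=> /(classify_infinite (infN infn))[->|[->|->]]; rewrite -?bd.
  + by do 2 left.
  + by left; right.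
  + by right.
- move=> infp; have bd := boundary_infinite (infP infp).
  split; [|split] => //; last exact: b_proper.
  apply/seteqP; split=> X; last by case=> ->.
  move=> XC; have [[alpha Xa] Xcl Xinv] := XC.
  case: (classify_infinite (infP infp) XC) => [->|h]; first by rewrite -bd; left.
  right; have [e pe_] : Apos D !=set0.
    by apply/set0P/eqP => p0; apply: infp; rewrite p0; exact: finite_set0.
  have [chi un nb] := exists_unbounded_not_b_closed pe_.
  apply: (infinite_pos_setT Xcl Xinv (_ : X chi)) => //.
  by case: h => -> //; apply/inf_cases; left.
Qed.
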